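(* Consider an $m\times n$ discrete conjugate net in $\mathbb{R}^3$ all of whose faces are strictly convex quadrilaterals. If the net has no pair of coplanar adjacent faces and all of its $3\times 3$-subnets are flexible, then the net is flexible as a whole.
   Context: An $m\times n$ discrete conjugate net is a polyhedral surface in $\mathbb{R}^3$ with planar quadrilateral faces connected in the combinatorics of an $m\times n$ square grid of faces: it is given by points $p_{i,j}\in\mathbb{R}^3$, $0\le i\le m$, $0\le j\le n$, such that for all $1\le i\le m$, $1\le j\le n$ the points $p_{i-1,j-1},p_{i-1,j},p_{i,j},p_{i,j-1}$ are, in this cyclic order, the vertices of a planar quadrilateral (a face). Strictly convex means that all angles of the quadrilateral are less than $180^\circ$. Self-intersections of the net are allowed. Two faces are adjacent if they share an edge of the grid; adjacent faces are coplanar if they lie in a common plane. A $3\times 3$-subnet is the net formed by the faces in three consecutive rows and three consecutive columns. An isometric deformation of a discrete conjugate net is a one-parameter smooth family of discrete conjugate nets (of the same combinatorics, containing the given net at parameter value $0$) in which every face undergoes a rigid motion in space. It is trivial if all faces undergo the same rigid motion. A net is flexible if it admits a non-trivial isometric deformation, and rigid otherwise.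
   Formalization: The net is required to have at least two faces (mn > 1): a net with a single face satisfies all the hypotheses vacuously but is rigid, so the claim fails there; nets with m = 0 or n = 0 have no faces. *)

(* Defs.v *)
From HB Require Import structures.
From mathcomp Require Import all_boot all_order all_algebra.
From mathcomp Require Import all_classical all_reals all_analysis.
Set Implicit Arguments.
Unset Strict Implicit.
Unset Printing Implicit Defensive.
Import Order.TTheory GRing.Theory Num.Theory.
Import numFieldNormedType.Exports.
Local Open Scope classical_set_scope.
Local Open Scope ring_scope.

Section Space.
Context {R : realType}.
Implicit Types u v w x y b : 'rV[R]_3.

Definition dot u v : R := \sum_(i < 3) u 0 i * v 0 i.

(* The library norm on row vectors is the sup norm, so the Euclidean one is
   defined separately. *)
Definition enorm u : R := Num.sqrt (dot u u).

(* Index arithmetic is modulo 3. *)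
Definition cross u v : 'rV[R]_3 :=
  \row_(i < 3) (u 0 (i + 1) * v 0 (i + 2%:R) - u 0 (i + 2%:R) * v 0 (i + 1)).

Definition coplanar (X : set 'rV[R]_3) : Prop :=
  exists (w : 'rV[R]_3) (c : R), w != 0 /\ forall x, X x -> dot w x = c.

Definition segment x y : set 'rV[R]_3 :=
  [set (1 - s) *: x + s *: y | s in [set s : R | 0 <= s <= 1]].

Definition rotation (A : 'M[R]_3) : Prop := A *m A^T = 1%:M /\ \det A = 1.

Definition motion (A : 'M[R]_3) b x : 'rV[R]_3 := x *m A + b.

(* Quadrilaterals: q 0, q 1, q 2, q 3 are the vertices in cyclic order; index
   arithmetic in 'I_4 is modulo 4. *)

(* A closed polygon without self-contact: consecutive sides share exactly their
   common vertex, opposite sides are disjoint.  This forces the four vertices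
   to be pairwise distinct. *)
Definition simple_quad (q : 'I_4 -> 'rV[R]_3) : Prop :=
  (forall k : 'I_4, segment (q k) (q (k + 1)) `&` segment (q (k + 1)) (q (k + 2%:R))
             = [set q (k + 1)]) /\
  (forall k : 'I_4, segment (q k) (q (k + 1))
             `&` segment (q (k + 2%:R)) (q (k + 3%:R)) = set0).

Definition planar_quad (q : 'I_4 -> 'rV[R]_3) : Prop :=
  coplanar (range q) /\ simple_quad q.

(* theta is the angle in [0, 2 pi[ of the counterclockwise turn from u to v in
   the plane orthogonal to the unit vector w, as seen from the tip of w. *)
Definition oriented_angle w u v (theta : R) : Prop :=
  [/\ 0 <= theta < 2 * pi,
      dot u v = enorm u * enorm v * cos theta &
      dot w (cross u v) = enorm u * enorm v * sin theta].

(* The interior of a simple polygon lies on the left of its sides when the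
   polygon is traversed counterclockwise.  Of the two unit normals w of the
   plane, the one for which q is counterclockwise is singled out by the sum of
   the four angles: it is 2 pi for that normal and 6 pi for the other one. *)
Definition interior_angles (q : 'I_4 -> 'rV[R]_3) (alpha : 'I_4 -> R) : Prop :=
  exists w : 'rV[R]_3,
    [/\ enorm w = 1,
        (forall k : 'I_4, dot w (q (k + 1) - q k) = 0),
        (forall k : 'I_4, oriented_angle w (q (k + 1) - q k) (q (k - 1) - q k)
                     (alpha k)) &
        \sum_k alpha k = 2 * pi].

Definition strictly_convex (q : 'I_4 -> 'rV[R]_3) : Prop :=
  exists alpha : 'I_4 -> R, interior_angles q alpha /\ forall k, alpha k < pi.

(* C^oo on the open interval ]-e, e[ *)
Definition smooth_on (e : R) (f : R -> R) : Prop :=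
  forall (k : nat) (t : R), - e < t < e -> derivable (derive1n k f) t 1.

End Space.

Definition net (R : realType) (m n : nat) : Type :=
  'I_m.+1 -> 'I_n.+1 -> 'rV[R]_3.

Section Nets.
Context {R : realType} {m n : nat}.
Implicit Types p : net R m n.

(* The face in row i and column j, with 0-based i and j; all the arguments of
   inord below are in range. *)
Definition face p (i : 'I_m) (j : 'I_n) : 'I_4 -> 'rV[R]_3 :=
  tnth [tuple p (inord i) (inord j); p (inord i) (inord j.+1);
              p (inord i.+1) (inord j.+1); p (inord i.+1) (inord j)].

Definition conjugate_net p : Prop := forall i j, planar_quad (face p i j).

Definition strictly_convex_faces p : Prop :=
  forall i j, strictly_convex (face p i j).

Definition adjacent_faces (f g : 'I_m * 'I_n) : Prop :=
  (f.1 = g.1 /\ (f.2.+1 = g.2 \/ g.2.+1 = f.2 :> nat)) \/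
  (f.2 = g.2 /\ (f.1.+1 = g.1 \/ g.1.+1 = f.1 :> nat)).

Definition coplanar_faces p (f g : 'I_m * 'I_n) : Prop :=
  coplanar (range (face p f.1 f.2) `|` range (face p g.1 g.2)).

Definition isometric_deformation p (e : R) (P : R -> net R m n) : Prop :=
  [/\ (forall i j, P 0 i j = p i j),
      (forall i j c, smooth_on e (fun t => P t i j 0 c)),
      (forall t : R, - e < t < e -> conjugate_net (P t)) &
      (forall t : R, - e < t < e -> forall (i : 'I_m) (j : 'I_n),
         exists (A : 'M[R]_3) (b : 'rV[R]_3), rotation A /\
           forall k, face (P t) i j k = motion A b (face p i j k))].

Definition trivial_deformation p (e : R) (P : R -> net R m n) : Prop :=
  forall t : R, - e < t < e ->
    exists (A : 'M[R]_3) (b : 'rV[R]_3), rotation A /\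
      forall (i : 'I_m) (j : 'I_n) k,
        face (P t) i j k = motion A b (face p i j k).

Definition flexible p : Prop :=
  exists (e : R) (P : R -> net R m n),
    [/\ 0 < e, isometric_deformation p e P & ~ trivial_deformation p e P].

(* The 3 x 3 net of the faces in rows a, a+1, a+2 and columns b, b+1, b+2;
   meaningful when a + 3 <= m and b + 3 <= n. *)
Definition subnet33 p (a b : nat) : net R 3 3 :=
  fun i j => p (inord (a + i)) (inord (b + j)).

End Nets.

(* Main.v *)
(* At an interior vertex, two opposite pairs of edges span two dot products, and
   each of them is an explicit function of the other: the spherical linkage with
   no two coplanar adjacent faces has one degree of freedom and stays on the
   branch where the orientations of the edge triples do not change.  Along a row
   or a column of vertices the changes of these dot products are proportional,
   so an isometric deformation amounts to one parameter per interior grid line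
   such that the parameters x_i, y_j of two crossing lines satisfy
   y_j = g_ij(x_i), with g_ij invertible near 0.  A flexible 3 x 3 subnet yields
   g_{i+1,j+1} o g_{i+1,j}^-1 o g_ij = g_{i,j+1} at points accumulating at 0 only
   (a smooth deformation may pause, or move to one side), but both sides belong
   to the class of functions obtained by field operations and square roots of
   positive functions, where zeros accumulating at 0 force vanishing near 0.
   Hence y_j := g_0j(t) and x_i := g_i0^-1(g_00(t)) satisfy all the relations,
   and they are the parameters of a deformation of the whole net. *)
Require Import Defs.
From mathcomp Require Import all_boot all_order all_algebra.
From mathcomp Require Import all_classical all_reals all_analysis.
From mathcomp Require Import ring lra zify.
Set Implicit Arguments.
Unset Strict Implicit.
Unset Printing Implicit Defensive.
Import Order.TTheory GRing.Theory Num.Theory.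
Import numFieldNormedType.Exports.
Local Open Scope classical_set_scope.
Local Open Scope ring_scope.

(** * Functions built from field operations and square roots *)

Section Radical.
Context {R : realType}.
Implicit Types (f g h : R -> R) (e c t : R).

(** The proportionality along a grid line is affine: in a planar face the lower edge is a fixed
    combination of the upper edge and of one side, so of all products between the lower edges of two
    neighbouring faces, only the part from the two upper edges can vary. Dot products replace
    angles, so that every relation is a polynomial identity or a square root. These roots raise the
    main obstacle: they fix a branch, and nothing controls the branch of a flexible window far from
    its initial position. The comparison is therefore made at the last parameter where the window is
    still congruent to that position; there the orientations are the original ones, and arbitrarily
    close to it the line parameters are nonzero. Strict convexity enters as the absence of straight
    corners, so that any three vertices of a face determine the fourth. Finite order of vanishing is
    not inherited by sums, since the cofactor of the power of [t] is merely continuous; hence the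
    identity theorem is proved for rings of functions that grow by one inverse or one square root at
    a time. *)

Inductive radical_on e : (R -> R) -> Prop :=
| Radical_cst c : radical_on e (fun=> c)
| Radical_id : radical_on e id
| Radical_add f g : radical_on e f -> radical_on e g ->
    radical_on e (fun t => f t + g t)
| Radical_mul f g : radical_on e f -> radical_on e g ->
    radical_on e (fun t => f t * g t)
| Radical_inv f : radical_on e f -> (forall t, - e < t < e -> f t != 0) ->
    radical_on e (fun t => (f t)^-1)
| Radical_sqrt f : radical_on e f -> (forall t, - e < t < e -> 0 < f t) ->
    radical_on e (fun t => Num.sqrt (f t))
| Radical_ext f g : radical_on e f -> (forall t, - e < t < e -> f t = g t) ->
    radical_on e g.

Lemma near_itv e t : - e < t < e -> \forall x \near t, - e < x < e.
Proof.
move=> /andP[h1 h2]; near=> x; apply/andP; split; near: x.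
- exact: lt_nbhsr.
- exact: lt_nbhsl.
Unshelve. all: by end_near. Qed.

(** The nonvanishing and positivity conditions of the constructors are those of the differentiation
    rules. The derivative stays in the class, and iterating this gives smoothness of every order. *)
Lemma radical_on_is_derive e f : radical_on e f -> exists f',
  radical_on e f' /\ forall t, - e < t < e -> is_derive t 1 f (f' t).
Proof.
elim=> {f} [c||f g _ [f' [rf' df]] _ [g' [rg' dg]]
  |f g rf [f' [rf' df]] rg [g' [rg' dg]]|f rf [f' [rf' df]] f0
  |f rf [f' [rf' df]] f0|f g _ [f' [rf' df]] fg].
- by exists (fun=> 0); split=> [|t _]; [exact: Radical_cst|exact: is_derive_cst].
- by exists (fun=> 1); split=> [|t _]; [exact: Radical_cst|exact: is_derive_id].
- exists (fun t => f' t + g' t); split=> [|t te]; first exact: Radical_add.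
  by have := @is_deriveD _ _ _ f g t 1 _ _ (df t te) (dg t te).
- exists (fun t => f t * g' t + g t * f' t); split=> [|t te].
    by apply: Radical_add; exact: Radical_mul.
  by have := @is_deriveM _ _ f g t 1 _ _ (df t te) (dg t te).
- exists (fun t => (-1) * f' t * ((f t)^-1 * (f t)^-1)); split=> [|t te].
    apply: Radical_mul; first by apply: Radical_mul => //; exact: Radical_cst.
    by apply: Radical_mul; exact: Radical_inv.
  have := is_deriveV (f0 t te) (df t te).
  move=> /is_derive_eq; apply; rewrite /GRing.scale /=.
  by have := f0 t te => ?; field.
- exists (fun t => f' t * (2 * Num.sqrt (f t))^-1); split=> [|t te].
    apply: Radical_mul => //; apply: Radical_inv.
      by apply: Radical_mul; [exact: Radical_cst|exact: Radical_sqrt].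
    by move=> t te; rewrite mulf_neq0 // gt_eqF // sqrtr_gt0 f0.
  have d1 := is_derive1_sqrt (f0 t te).
  have := @is_derive1_comp R Num.sqrt f t _ _ d1 (df t te).
  move=> /is_derive_eq; apply; rewrite /GRing.scale /=.
  by rewrite mulrC.
- exists f'; split=> // t te; apply: near_eq_is_derive (df t te).
  by near do apply: fg; exact: near_itv.
Unshelve. all: by end_near. Qed.

Lemma radical_on_smooth e f : radical_on e f -> smooth_on e f.
Proof.
move=> rf k; have : radical_on e (derive1n k f).
  elim: k => [//|k /radical_on_is_derive[f' [rf' df]]].
  apply: Radical_ext rf' _ => t te.
  by rewrite /= derive1E; have [_ ->] := df t te.
by move=> /radical_on_is_derive[f' [_ df]] t /df[].
Qed.

Lemma smooth_on_continuous e f t : smooth_on e f -> - e < t < e ->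
  {for t, continuous f}.
Proof.
by move=> /(_ 0%N t) sf /sf /derivable1_diffP /differentiable_continuous.
Qed.

Lemma radical_on_le e e' f : e' <= e -> radical_on e f -> radical_on e' f.
Proof.
move=> le; have sub t : - e' < t < e' -> - e < t < e.
  by move=> /andP[? ?]; apply/andP; split; lra.
elim=> {f} [c||f g _ ? _ ?|f g _ ? _ ?|f _ rf f0|f _ rf f0|f g _ rf fg].
- exact: Radical_cst.
- exact: Radical_id.
- exact: Radical_add.
- exact: Radical_mul.
- by apply: Radical_inv => // t /sub; exact: f0.
- by apply: Radical_sqrt => // t /sub; exact: f0.
- by apply: Radical_ext rf _ => t /sub; exact: fg.
Qed.

Lemma radical_on_comp e e' f g : radical_on e f -> radical_on e' g ->
  (forall t, - e' < t < e' -> - e < g t < e) -> radical_on e' (f \o g).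
Proof.
move=> rf rg sub.
elim: rf => {f} [c||f1 f2 _ ? _ ?|f1 f2 _ ? _ ?|f _ rf f0|f _ rf f0|f f2 _ rf fg].
- exact: Radical_cst.
- exact: rg.
- exact: (@Radical_add _ (f1 \o g) (f2 \o g)).
- exact: (@Radical_mul _ (f1 \o g) (f2 \o g)).
- by apply: (@Radical_inv _ (f \o g)) => // t /sub; exact: f0.
- by apply: (@Radical_sqrt _ (f \o g)) => // t /sub; exact: f0.
- by apply: Radical_ext rf _ => t /sub; exact: fg.
Qed.

(** Germs at 0: the half-width is existential, so that inverses, roots and compositions may shrink
    it. *)
Definition radical f := exists2 e, 0 < e & radical_on e f.

Lemma near0_ex (P : R -> Prop) : (\forall t \near (0 : R), P t) ->
  exists2 e, 0 < e & forall t, - e < t < e -> P t.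
Proof.
move=> /nbhs_ballP[e /= e0 eP]; exists e => // t te; apply: eP.
by rewrite /ball /= sub0r normrN ltr_norml.
Qed.

Lemma ex_near0 (P : R -> Prop) e : 0 < e -> (forall t, - e < t < e -> P t) ->
  \forall t \near (0 : R), P t.
Proof.
move=> e0 eP; apply/nbhs_ballP; exists e => // t.
by rewrite /ball /= sub0r normrN ltr_norml; exact: eP.
Qed.

Lemma radical_continuous f : radical f -> {for 0, continuous f}.
Proof.
move=> [e e0 /radical_on_smooth/smooth_on_continuous]; apply.
by rewrite oppr_lt0 e0.
Qed.

Lemma radical_ext f g : radical f -> (\forall t \near (0 : R), f t = g t) ->
  radical g.
Proof.
move=> [e e0 rf] /near0_ex[e' e'0 fg].
exists (Num.min e e'); first by rewrite lt_min e0 e'0.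
apply: Radical_ext (radical_on_le _ rf) _; first by rewrite ge_min lexx.
by move=> t /andP[]; rewrite ltrNl !lt_min => /andP[? ?] /andP[? ?];
  apply: fg; apply/andP; split; lra.
Qed.

Lemma radical2 f g : radical f -> radical g ->
  exists e, [/\ 0 < e, radical_on e f & radical_on e g].
Proof.
move=> [e e0 rf] [e' e'0 rg]; exists (Num.min e e').
by split; [rewrite lt_min e0 e'0 //|apply: radical_on_le rf|apply: radical_on_le rg];
  rewrite ge_min lexx ?orbT.
Qed.

Lemma radical_cst c : radical (fun=> c).
Proof. by exists 1 => //; exact: Radical_cst. Qed.

Lemma radical_id : radical id.
Proof. by exists 1 => //; exact: Radical_id. Qed.

Lemma radicalD f g : radical f -> radical g -> radical (fun t => f t + g t).
Proof.
by move=> rf /(radical2 rf)[e [e0 ? ?]]; exists e => //; exact: Radical_add.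
Qed.

Lemma radicalM f g : radical f -> radical g -> radical (fun t => f t * g t).
Proof.
by move=> rf /(radical2 rf)[e [e0 ? ?]]; exists e => //; exact: Radical_mul.
Qed.

Lemma radicalN f : radical f -> radical (fun t => - f t).
Proof.
move=> rf; apply: radical_ext (radicalM (radical_cst (-1)) rf) _.
by near=> t; rewrite mulN1r.
Unshelve. all: by end_near. Qed.

Lemma radicalB f g : radical f -> radical g -> radical (fun t => f t - g t).
Proof. by move=> rf rg; apply: radicalD => //; exact: radicalN. Qed.

Lemma radicalX f n : radical f -> radical (fun t => f t ^+ n).
Proof.
move=> rf; elim: n => [|n IH]; first exact: radical_cst.
by apply: radical_ext (radicalM rf IH) _; near=> t; rewrite exprS.
Unshelve. all: by end_near. Qed.

Lemma continuous_near0_gt0 f : {for 0, continuous f} -> 0 < f 0 ->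
  \forall t \near (0 : R), 0 < f t.
Proof. by move=> cf f0; exact: (cf _ (lt_nbhsr f0)). Qed.

Lemma continuous_near0_neq0 f : {for 0, continuous f} -> f 0 != 0 ->
  \forall t \near (0 : R), f t != 0.
Proof.
move=> cf f0; have h : nbhs (f 0) [set y | y != 0].
  by apply: open_nbhs_nbhs; split=> //; exact: open_neq.
exact: (cf _ h).
Qed.

Lemma radicalV f : radical f -> f 0 != 0 -> radical (fun t => (f t)^-1).
Proof.
move=> rf f0; have /near0_ex[e' e'0 nf] := continuous_near0_neq0 (radical_continuous rf) f0.
have [e e0 {}rf] := rf.
exists (Num.min e e'); first by rewrite lt_min e0 e'0.
apply: Radical_inv; first by apply: radical_on_le rf; rewrite ge_min lexx.
by move=> t /andP[]; rewrite ltrNl !lt_min => /andP[? ?] /andP[? ?];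
  apply: nf; apply/andP; split; lra.
Qed.

Lemma radical_div f g : radical f -> radical g -> g 0 != 0 ->
  radical (fun t => f t / g t).
Proof. by move=> rf rg g0; apply: radicalM => //; exact: radicalV. Qed.

Lemma radical_sqrt f : radical f -> 0 < f 0 -> radical (fun t => Num.sqrt (f t)).
Proof.
move=> rf f0; have /near0_ex[e' e'0 nf] := continuous_near0_gt0 (radical_continuous rf) f0.
have [e e0 {}rf] := rf.
exists (Num.min e e'); first by rewrite lt_min e0 e'0.
apply: Radical_sqrt; first by apply: radical_on_le rf; rewrite ge_min lexx.
by move=> t /andP[]; rewrite ltrNl !lt_min => /andP[? ?] /andP[? ?];
  apply: nf; apply/andP; split; lra.
Qed.

Lemma radical_near_lt f e : radical f -> f 0 = 0 -> 0 < e ->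
  \forall t \near (0 : R), - e < f t < e.
Proof.
move=> /radical_continuous cf f0 e0.
have h : \forall x \near f 0, - e < x < e.
  by rewrite f0; apply: near_itv; rewrite oppr_lt0 e0.
exact: (cf _ h).
Qed.

Lemma radical_comp f g : radical f -> radical g -> g 0 = 0 ->
  radical (fun t => f (g t)).
Proof.
move=> [e e0 rf] rg g0; have /near0_ex[e' e'0 sub] := radical_near_lt rg g0 e0.
have [e2 e20 {}rg] := rg.
exists (Num.min e2 e'); first by rewrite lt_min e20 e'0.
apply: (radical_on_comp rf); first by apply: radical_on_le rg; rewrite ge_min lexx.
by move=> t /andP[]; rewrite ltrNl !lt_min => /andP[? ?] /andP[? ?];
  apply: sub; apply/andP; split; lra.
Qed.

Lemma near0_comp g (P : R -> Prop) : {for 0, continuous g} -> g 0 = 0 ->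
  (\forall t \near (0 : R), P t) -> \forall t \near (0 : R), P (g t).
Proof. by move=> cg g0 nP; apply: (cg P); rewrite g0. Qed.

End Radical.

(** * The identity theorem for radical functions *)

Section Identity.
Context {R : realType}.
Implicit Types (f g h u : R -> R) (e c t : R) (K : (R -> R) -> Prop).

Definition finite_order f :=
  (\forall t \near (0 : R), f t = 0) \/
  exists (r : nat) u, [/\ {for 0, continuous u}, u 0 != 0 &
    \forall t \near (0 : R), f t = t ^+ r * u t].

Lemma continuous_near0_eq f g : {for 0, continuous f} -> {for 0, continuous g} ->
  (\forall t \near (0 : R), t != 0 -> f t = g t) -> \forall t \near (0 : R), f t = g t.
Proof.
move=> cf cg fg; suff f0 : f 0 = g 0.
  by near=> t; have [->//|] := eqVneq t 0; near: t.
have c0 : {for 0, continuous (fun t => f t - g t)} by apply: cvgB.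
apply/eqP; rewrite -subr_eq0; apply/negPn/negP => /(continuous_near0_neq0 c0) n0.
have /near0_ex[e e0 he] : \forall t \near (0 : R), t = 0.
  near=> t; apply/eqP; apply: contraT => t0.
  have : f t = g t by move: t0; near: t.
  have /negPf ft : f t - g t != 0 by near: t.
  by move/eqP; rewrite -subr_eq0 ft.
have : e / 2 = 0 by apply: he; lra.
lra.
Unshelve. all: by end_near. Qed.

Lemma finite_order_ext f g : (\forall t \near (0 : R), f t = g t) ->
  finite_order f -> finite_order g.
Proof.
move=> fg [f0|[r [u [cu u0 fu]]]]; [left|right].
  by near=> t; rewrite -(near fg t) //; near: t.
by exists r, u; split=> //; near=> t; rewrite -(near fg t) //; near: t.
Unshelve. all: by end_near. Qed.

Lemma finite_order_continuous f : finite_order f -> {for 0, continuous f}.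
Proof.
have loc g h : (\forall t \near (0 : R), g t = h t) -> {for 0, continuous h} ->
    {for 0, continuous g}.
  move=> gh ch; rewrite /prop_for /continuous_at (nbhs_singleton gh).
  apply: cvg_trans ch; apply: near_eq_cvg; near=> t; apply/esym; near: t; exact: gh.
case=> [f0|[r [u [cu u0 fu]]]].
  exact: loc f0 (cvg_cst _).
by apply: loc fu _; apply: cvgM => //; exact: exprn_continuous.
Unshelve. all: by end_near. Qed.

Lemma finite_order_mulX f : finite_order f -> finite_order (fun t => t * f t).
Proof.
move=> [f0|[r [u [cu u0 fu]]]]; [left|right].
  by near=> t; rewrite (near f0 t) ?mulr0.
by exists r.+1, u; split=> //; near=> t; rewrite (near fu t) // exprS mulrA.
Unshelve. all: by end_near. Qed.

Lemma finite_order_divX f : {for 0, continuous f} ->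
  finite_order (fun t => t * f t) -> finite_order f.
Proof.
move=> cf [f0|[[|r] [u [cu u0 fu]]]].
- left; apply: continuous_near0_eq => //; first exact: cvg_cst.
  near=> t => t0; apply: (mulfI t0); rewrite mulr0; near: t; exact: f0.
- by move: (nbhs_singleton fu) u0; rewrite mul0r expr0 mul1r => <-; rewrite eqxx.
- right; exists r, u; split=> //; apply: continuous_near0_eq => //.
    by apply: cvgM => //; exact: exprn_continuous.
  near=> t => t0; apply: (mulfI t0); rewrite mulrA -exprS; near: t; exact: fu.
Unshelve. all: by end_near. Qed.

Lemma finite_order_mulXn f n : finite_order f ->
  finite_order (fun t => t ^+ n * f t).
Proof.
elim: n => [|n IH] ordf; first by apply: finite_order_ext ordf; near=> t; rewrite expr0 mul1r.
apply: finite_order_ext (finite_order_mulX (IH ordf)).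
by near=> t; rewrite exprS mulrA.
Unshelve. all: by end_near. Qed.

Lemma finite_order_divXn f n : {for 0, continuous f} ->
  finite_order (fun t => t ^+ n * f t) -> finite_order f.
Proof.
move=> cf; elim: n => [|n IH] ordf.
  by apply: finite_order_ext ordf; near=> t; rewrite expr0 mul1r.
apply: IH; apply: finite_order_divX.
  by apply: cvgM => //; exact: exprn_continuous.
by apply: finite_order_ext ordf; near=> t; rewrite exprS mulrA.
Unshelve. all: by end_near. Qed.

Lemma finite_order_unit u f : {for 0, continuous u} -> u 0 != 0 ->
  finite_order (fun t => f t * u t) -> finite_order f.
Proof.
move=> cu u0 ordf; have nu := continuous_near0_neq0 cu u0.
case: ordf => [f0|[r [v [cv v0 fv]]]]; [left|right].
  near=> t; have ut : u t != 0 by near: t.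
  by apply: (mulIf ut); rewrite mul0r; near: t.
exists r, (fun t => v t / u t); split=> //.
- by apply: cvgM => //; exact: cvgV.
- by rewrite mulf_neq0 ?invr_neq0.
- near=> t; have ut : u t != 0 by near: t.
  by apply: (mulIf ut); rewrite mulrA divfK //; near: t.
Unshelve. all: by end_near. Qed.

Lemma unit_finite_order u : {for 0, continuous u} -> u 0 != 0 -> finite_order u.
Proof.
move=> cu u0; right; exists 0%N, u; split=> //.
by near=> t; rewrite expr0 mul1r.
Unshelve. all: by end_near. Qed.

(** The ring operations belong to the record because [finite_order] alone is not stable under sums;
    each enlargement of [K] has to re-establish it for all its elements. *)
Record valuation_ring K : Prop := ValuationRing {
  vr_ext : forall f g, K f -> (\forall t \near (0 : R), f t = g t) -> K g;
  vr_cst : forall c, K (fun=> c);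
  vr_id : K id;
  vr_add : forall f g, K f -> K g -> K (fun t => f t + g t);
  vr_mul : forall f g, K f -> K g -> K (fun t => f t * g t);
  vr_order : forall f, K f -> finite_order f }.

Lemma poly_valuation_ring : valuation_ring
  (fun f => exists p : {poly R}, \forall t \near (0 : R), f t = p.[t]).
Proof.
split.
- move=> f g [p fp] fg; exists p; near=> t; rewrite -(near fg t) //.
  by near: t.
- by move=> c; exists c%:P; near=> t; rewrite hornerC.
- by exists 'X; near=> t; rewrite hornerX.
- move=> f g [p fp] [q gq]; exists (p + q); near=> t.
  by rewrite hornerD (near fp t) // (near gq t).
- move=> f g [p fp] [q gq]; exists (p * q); near=> t.
  by rewrite hornerM (near fp t) // (near gq t).
- move=> f [p fp]; have [p0|p0] := eqVneq p 0.
    by left; near=> t; rewrite (near fp t) // p0 horner0.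
  right; have [n [q nq pq]] := multiplicity_XsubC p 0.
  exists n, (horner q); split.
  + exact: continuous_horner.
  + by move: nq; rewrite p0.
  + by near=> t; rewrite (near fp t) // pq hornerM subr0 horner_exp hornerX mulrC.
Unshelve. all: by end_near. Qed.

Lemma vr_continuous K f : valuation_ring K -> K f -> {for 0, continuous f}.
Proof. by move=> vK Kf; apply: finite_order_continuous; exact: vr_order Kf. Qed.

(** The enlarged ring is the localization at [g], described without fractions: the functions that
    some power of [g] brings back into [K]. As [g] is a unit at 0, that power does not change the
    order. *)
Lemma valuation_ring_frac K g : valuation_ring K -> K g -> g 0 != 0 ->
  exists K', [/\ valuation_ring K', (forall f, K f -> K' f) & K' (fun t => (g t)^-1)].
Proof.
move=> vK Kg g0.
exists (fun f => exists n : nat, K (fun t => f t * g t ^+ n)).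
have KX n : K (fun t => g t ^+ n).
  elim: n => [|n IH]; first exact: vr_cst.
  by apply: vr_ext (vr_mul vK Kg IH) _ => //; near=> t; rewrite exprS.
have inj f : K f -> exists n : nat, K (fun t => f t * g t ^+ n).
  by move=> Kf; exists 0%N; apply: vr_ext Kf _ => //; near=> t; rewrite expr0 mulr1.
have cg := vr_continuous vK Kg.
split=> //; last first.
  exists 1%N; apply: vr_ext (vr_cst vK 1) _ => //; near=> t.
  by rewrite mulVf //; near: t; exact: continuous_near0_neq0.
split.
- move=> f h [n Kf] fh; exists n; apply: vr_ext Kf _ => //; near=> t.
  by rewrite (near fh t).
- by move=> c; apply: inj; exact: vr_cst.
- by apply: inj; exact: vr_id.
- move=> f h [n Kf] [k Kh]; exists (n + k)%N.
  apply: vr_ext (vr_add vK (vr_mul vK Kf (KX k)) (vr_mul vK Kh (KX n))) _ => //.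
  by near=> t; rewrite /= exprD; ring.
- move=> f h [n Kf] [k Kh]; exists (n + k)%N.
  apply: vr_ext (vr_mul vK Kf Kh) _ => //.
  by near=> t; rewrite /= exprD; ring.
- move=> f [n Kf]; apply: finite_order_unit (vr_order vK Kf) => //.
    exact: vr_continuous (KX n).
  by rewrite expf_neq0.
Unshelve. all: by end_near. Qed.

(* With [w := sqrt g], the order of [a + b w] is read off the norm
   [a ^ 2 - b ^ 2 g], which lies in [K]; only when [a] and [b] have the same
   order can a cancellation occur, and then [a - b w] has that same order. *)
Lemma valuation_ring_sqrt K g : valuation_ring K -> K g -> 0 < g 0 ->
  exists K', [/\ valuation_ring K', (forall f, K f -> K' f) &
    K' (fun t => Num.sqrt (g t))].
Proof.
move=> vK Kg g0; set w := fun t => Num.sqrt (g t).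
exists (fun f => exists a b, [/\ K a, K b & \forall t \near (0 : R), f t = a t + b t * w t]).
have cg := vr_continuous vK Kg.
have gp := continuous_near0_gt0 cg g0.
have w2 : \forall t \near (0 : R), w t ^+ 2 = g t.
  by near=> t; rewrite sqr_sqrtr // ltW //; near: t.
have cw : {for 0, continuous w}.
  apply: (@continuous_comp _ _ _ g Num.sqrt) => //; exact: sqrt_continuous.
have w0 : 0 < w 0 by rewrite sqrtr_gt0.
have inj f : K f -> exists a b, [/\ K a, K b & \forall t \near (0 : R), f t = a t + b t * w t].
  move=> Kf; exists f, (fun=> 0); split=> //; first exact: vr_cst.
  by near=> t; rewrite mul0r addr0.
split=> //; last first.
  exists (fun=> 0), (fun=> 1); split; [exact: vr_cst|exact: vr_cst|].
  by near=> t; rewrite add0r mul1r.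
split.
- move=> f h [a [b [Ka Kb fab]]] fh; exists a, b; split=> //; near=> t.
  by rewrite -(near fh t) //; near: t.
- by move=> c; apply: inj; exact: vr_cst.
- by apply: inj; exact: vr_id.
- move=> f h [a [b [Ka Kb fab]]] [a' [b' [Ka' Kb' hab]]].
  exists (fun t => a t + a' t), (fun t => b t + b' t); split; try exact: vr_add.
  by near=> t; rewrite (near fab t) // (near hab t) //; ring.
- move=> f h [a [b [Ka Kb fab]]] [a' [b' [Ka' Kb' hab]]].
  exists (fun t => a t * a' t + (b t * b' t) * g t), (fun t => a t * b' t + b t * a' t).
  split; [apply: vr_add => //; apply: vr_mul => //; exact: vr_mul
    |by apply: vr_add => //; exact: vr_mul|].
  by near=> t; rewrite (near fab t) // (near hab t) // -(near w2 t) //; ring.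
move=> f [a [b [Ka Kb fab]]].
suff : finite_order (fun t => a t + b t * w t).
  by apply: finite_order_ext; near=> t; apply/esym; near: t.
have ca := vr_continuous vK Ka.
have [a0|[p [al [cal al0 ap]]]] := vr_order vK Ka.
  apply: (@finite_order_ext (fun t => b t * w t)).
    by near=> t; rewrite (near a0 t) // add0r.
  apply: (@finite_order_unit (fun t => (w t)^-1)).
  - by apply: cvgV => //; rewrite gt_eqF.
  - by rewrite invr_neq0 // gt_eqF.
  apply: finite_order_ext (vr_order vK Kb); near=> t.
  by rewrite mulfK //; near: t; apply: continuous_near0_neq0; rewrite ?gt_eqF.
have [b0|[q [be [cbe be0 bq]]]] := vr_order vK Kb.
  apply: finite_order_ext (vr_order vK Ka).
  by near=> t; rewrite (near b0 t) // mul0r addr0.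
have cX n := @exprn_continuous R n 0.
have [pq|qp|pq] := ltngtP p q.
- apply: (@finite_order_ext (fun t => t ^+ p * (al t + t ^+ (q - p) * be t * w t))).
    near=> t; rewrite (near ap t) // (near bq t) //.
    by rewrite -[in RHS](subnKC (ltnW pq)) exprD; ring.
  apply: finite_order_mulXn; apply: unit_finite_order.
    by apply: cvgD => //; apply: cvgM => //; apply: cvgM => //; exact: cX.
  by rewrite expr0n subn_eq0 leqNgt pq /= !mul0r addr0.
- apply: (@finite_order_ext (fun t => t ^+ q * (t ^+ (p - q) * al t + be t * w t))).
    near=> t; rewrite (near ap t) // (near bq t) //.
    by rewrite -[in RHS](subnKC (ltnW qp)) exprD; ring.
  apply: finite_order_mulXn; apply: unit_finite_order.
    by apply: cvgD; apply: cvgM => //; exact: cX.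
  by rewrite expr0n subn_eq0 leqNgt qp /= mul0r add0r mulf_neq0 // gt_eqF.
apply: (@finite_order_ext (fun t => t ^+ p * (al t + be t * w t))).
  by near=> t; rewrite (near ap t) // (near bq t) // pq; ring.
apply: finite_order_mulXn.
have cbw : {for 0, continuous (fun t => be t * w t)} by apply: cvgM.
have cF : {for 0, continuous (fun t => al t + be t * w t)} by apply: cvgD.
have [F0|] := eqVneq (al 0 + be 0 * w 0) 0; last exact: unit_finite_order.
apply: (@finite_order_unit (fun t => al t - be t * w t)); first by apply: cvgB.
  by apply: contraNneq al0 => E0; apply/eqP; lra.
apply: (@finite_order_divXn _ (p + p)).
  by apply: cvgM => //; apply: cvgB.
have KN : K (fun t => a t * a t + (-1) * (b t * b t * g t)).
  apply: vr_add => //; first exact: vr_mul.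
  by apply: vr_mul; [|exact: vr_cst|apply: vr_mul => //; exact: vr_mul].
apply: finite_order_ext (vr_order vK KN); near=> t.
rewrite (near ap t) // (near bq t) // -(near w2 t) // pq exprD; ring.
Unshelve. all: by end_near. Qed.

(** The derivation of [f] is read as a tower of extensions. The start [K] is arbitrary, so that the
    second operand of a sum or product is adjoined to the ring already reached for the first. *)
Lemma radical_valuation_ring e f K : 0 < e -> radical_on e f -> valuation_ring K ->
  exists K', [/\ valuation_ring K', (forall f, K f -> K' f) & K' f].
Proof.
move=> e0 rf; have e00 : - e < 0 < e by rewrite oppr_lt0 e0.
elim: rf K => {f} [c||f g _ IHf _ IHg|f g _ IHf _ IHg|f _ IH f0|f _ IH f0|f g _ IH fg] K vK.
- by exists K; split=> //; exact: vr_cst.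
- by exists K; split=> //; exact: vr_id.
- have [K1 [v1 s1 k1]] := IHf K vK; have [K2 [v2 s2 k2]] := IHg K1 v1.
  by exists K2; split=> // [h /s1/s2 //|]; apply: vr_add => //; exact: s2.
- have [K1 [v1 s1 k1]] := IHf K vK; have [K2 [v2 s2 k2]] := IHg K1 v1.
  by exists K2; split=> // [h /s1/s2 //|]; apply: vr_mul => //; exact: s2.
- have [K1 [v1 s1 k1]] := IH K vK.
  have [K2 [v2 s2 k2]] := valuation_ring_frac v1 k1 (f0 0 e00).
  by exists K2; split=> // h /s1/s2.
- have [K1 [v1 s1 k1]] := IH K vK.
  have [K2 [v2 s2 k2]] := valuation_ring_sqrt v1 k1 (f0 0 e00).
  by exists K2; split=> // h /s1/s2.
- have [K1 [v1 s1 k1]] := IH K vK.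
  by exists K1; split=> //; apply: vr_ext k1 _ => //; exact: ex_near0 fg.
Qed.

(** A function [t ^+ r * u t] with [u] continuous and [u 0 != 0] has no zero near 0 except possibly
    0 itself. *)
Lemma radical_identity f : radical f ->
  (forall e, 0 < e -> exists t, [/\ - e < t < e, t != 0 & f t = 0]) ->
  \forall t \near (0 : R), f t = 0.
Proof.
move=> [e e0 rf] zeros.
have [K [vK _ Kf]] := radical_valuation_ring e0 rf poly_valuation_ring.
have [//|[r [u [cu u0 fu]]]] := vr_order vK Kf.
have nu := continuous_near0_neq0 cu u0.
have /near0_ex[e1 e10 h1] : \forall t \near (0 : R), f t = t ^+ r * u t /\ u t != 0.
  by near=> t; split; near: t.
have [t [/h1[ftE ut] t0 ft]] := zeros _ e10.
by move/eqP: ft; rewrite ftE mulf_eq0 expf_eq0 (negPf t0) (negPf ut) andbF.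
Unshelve. all: by end_near. Qed.

End Identity.

(** * Vectors, frames and rotations *)

Section Vectors.
Context {R : realType}.
Implicit Types (a b c d u v w x y : 'rV[R]_3) (A : 'M[R]_3) (k : R).

Definition trip u v w : R := dot (cross u v) w.

Lemma dotE u v : dot u v = u 0 0 * v 0 0 + u 0 1 * v 0 1 + u 0 2%:R * v 0 2%:R.
Proof.
rewrite /dot !big_ord_recl big_ord0 addr0 addrA.
by congr (_ + _ + _); congr (_ * _); congr (_ 0 _); exact: val_inj.
Qed.

Lemma cross0 u v : cross u v 0 0 = u 0 1 * v 0 2%:R - u 0 2%:R * v 0 1.
Proof. by rewrite mxE !add0r. Qed.

Lemma cross1 u v : cross u v 0 1 = u 0 2%:R * v 0 0 - u 0 0 * v 0 2%:R.
Proof.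
rewrite mxE; have -> : (1 + 1 : 'I_3) = 2%:R by exact: val_inj.
by have -> : (1 + 2%:R : 'I_3) = 0 by exact: val_inj.
Qed.

Lemma cross2 u v : cross u v 0 2%:R = u 0 0 * v 0 1 - u 0 1 * v 0 0.
Proof.
rewrite mxE; have -> : (2%:R + 1 : 'I_3) = 0 by exact: val_inj.
by have -> : (2%:R + 2%:R : 'I_3) = 1 by exact: val_inj.
Qed.

Lemma row3P u v :
  [/\ u 0 0 = v 0 0, u 0 1 = v 0 1 & u 0 2%:R = v 0 2%:R] <-> u = v.
Proof.
split=> [[h0 h1 h2]|->//]; apply/rowP => -[[|[|[|//]]] i3].
- by rewrite (_ : Ordinal i3 = 0) //; exact: val_inj.
- by rewrite (_ : Ordinal i3 = 1) //; exact: val_inj.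
- by rewrite (_ : Ordinal i3 = 2%:R) //; exact: val_inj.
Qed.

Lemma coordD u v i : (u + v) 0 i = u 0 i + v 0 i. Proof. by rewrite mxE. Qed.

Lemma coordZ k u i : (k *: u) 0 i = k * u 0 i. Proof. by rewrite mxE. Qed.

Definition coordE := (coordD, coordZ, dotE, cross0, cross1, cross2).

Lemma dotC u v : dot u v = dot v u.
Proof. by rewrite !dotE; ring. Qed.

Lemma dotDl u v w : dot (u + v) w = dot u w + dot v w.
Proof. by rewrite !dotE !mxE; ring. Qed.

Lemma dotDr u v w : dot w (u + v) = dot w u + dot w v.
Proof. by rewrite !dotE !mxE; ring. Qed.

Lemma dotZl k u v : dot (k *: u) v = k * dot u v.
Proof. by rewrite !dotE !mxE; ring. Qed.

Lemma dotZr k u v : dot v (k *: u) = k * dot v u.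
Proof. by rewrite !dotE !mxE; ring. Qed.

Lemma dotNl u v : dot (- u) v = - dot u v.
Proof. by rewrite -scaleN1r dotZl mulN1r. Qed.

Lemma dotNr u v : dot v (- u) = - dot v u.
Proof. by rewrite -scaleN1r dotZr mulN1r. Qed.

Lemma dot0r u : dot u 0 = 0.
Proof. by rewrite dotE !mxE; ring. Qed.

Definition dot_lin := (dotDl, dotDr, dotZl, dotZr, dotNl, dotNr).

Lemma dotvv_eq0 u : (dot u u == 0) = (u == 0).
Proof.
apply/eqP/eqP => [|->]; last by rewrite dot0r.
rewrite dotE => h; apply/row3P; rewrite !mxE; split; nra.
Qed.

Lemma dotvv_ge0 u : 0 <= dot u u.
Proof. by rewrite dotE; nra. Qed.

Definition gram u v := dot u u * dot v v - dot u v ^+ 2.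

Lemma gramE u v : gram u v = dot (cross u v) (cross u v).
Proof. by rewrite /gram !coordE; ring. Qed.

Lemma gram_gt0 u v : cross u v != 0 -> 0 < gram u v.
Proof. by move=> uv0; rewrite gramE lt_neqAle dotvv_ge0 andbT eq_sym dotvv_eq0. Qed.

Lemma trip_cross u v w : trip u v w != 0 -> cross u v != 0.
Proof. by apply: contraNneq; rewrite /trip => ->; rewrite dotC dot0r. Qed.

Lemma trip_rot u v w : trip u v w = trip v w u.
Proof. by rewrite /trip !coordE; ring. Qed.

Lemma trip_swap u v w : trip u v w = - trip v u w.
Proof. by rewrite /trip !coordE; ring. Qed.

(** The product of two determinants is the determinant of the mixed Gram matrix of their rows, here
    expanded along the column of [y]. *)
Lemma trip_gram u v x y : trip u v x * trip u v y =
  dot x y * gram u v - dot v y * (dot u u * dot v x - dot u v * dot u x)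
  + dot u y * (dot u v * dot v x - dot v v * dot u x).
Proof. by rewrite /trip /gram !coordE; ring. Qed.

(** Coordinates in the frame [u], [v], [cross u v], multiplied by the Gram determinant to avoid
    division. *)
Lemma frameE u v x : gram u v *: x =
  (dot x u * dot v v - dot x v * dot u v) *: u +
  (dot x v * dot u u - dot x u * dot u v) *: v + trip u v x *: cross u v.
Proof.
by apply/row3P; rewrite /trip /gram !coordE; split; ring.
Qed.

Lemma frame_inj u v x y : cross u v != 0 -> dot x u = dot y u ->
  dot x v = dot y v -> trip u v x = trip u v y -> x = y.
Proof.
move=> /gram_gt0/lt0r_neq0 g0 hu hv ht; apply: (scalerI g0).
by rewrite !frameE hu hv ht.
Qed.

Lemma trip_addl u v w x : trip (u + v) w x = trip u w x + trip v w x.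
Proof. by rewrite /trip !coordE; ring. Qed.

Lemma trip_scalel k u w x : trip (k *: u) w x = k * trip u w x.
Proof. by rewrite /trip !coordE; ring. Qed.

Lemma trip_addr u v w x : trip w x (u + v) = trip w x u + trip w x v.
Proof. by rewrite /trip !coordE; ring. Qed.

Lemma trip_scaler k u w x : trip w x (k *: u) = k * trip w x u.
Proof. by rewrite /trip !coordE; ring. Qed.

Lemma trip_vvl u v : trip u v u = 0.
Proof. by rewrite /trip !coordE; ring. Qed.

Lemma trip_vvr u v : trip u v v = 0.
Proof. by rewrite /trip !coordE; ring. Qed.

Lemma dot_mulmx u v : dot u v = (u *m v^T) 0 0.
Proof. by rewrite mxE; apply: eq_bigr => i _; rewrite mxE. Qed.

Lemma dot_rotation A u v : rotation A -> dot (u *m A) (v *m A) = dot u v.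
Proof.
by move=> [AA _]; rewrite !dot_mulmx trmx_mul mulmxA -(mulmxA u) AA mulmx1.
Qed.

Definition rows3 u v w : 'M[R]_3 :=
  \matrix_(i < 3) (if i == 0 then u else if i == 1 then v else w).

Lemma row_rows3 u v w i :
  row i (rows3 u v w) = if i == 0 then u else if i == 1 then v else w.
Proof. by apply/rowP => j; rewrite !mxE; case: ifP; [|case: ifP]. Qed.

Lemma rows3_mul u v w A : rows3 u v w *m A = rows3 (u *m A) (v *m A) (w *m A).
Proof.
by apply/row_matrixP => i; rewrite row_mul !row_rows3; case: ifP; [|case: ifP].
Qed.

Lemma det_rows3 u v w : \det (rows3 u v w) = trip u v w.
Proof.
rewrite (expand_det_row _ 0) !big_ord_recl big_ord0 /cofactor.
rewrite !(expand_det_row _ (0 : 'I_2)) !big_ord_recl !big_ord0 /cofactor.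
rewrite !det_mx11 !mxE /=.
rewrite /trip !coordE.
have E x (i : 'I_3) : x 0 i = [:: x 0 0; x 0 1; x 0 2%:R]`_i.
  by case: i => [[|[|[|//]]] i3] /=; congr (x 0 _); exact: val_inj.
rewrite !(E _ (lift _ _)) /bump /= -[ord0]/(0 : 'I_3).
by ring.
Qed.

Lemma trip_rotation A u v w : rotation A ->
  trip (u *m A) (v *m A) (w *m A) = trip u v w.
Proof. by move=> [_ A1]; rewrite -!det_rows3 -rows3_mul det_mulmx A1 mulr1. Qed.

(** The matrix sends the frame [u], [v], [cross u v] to its primed counterpart. Both frames have the
    same Gram matrix, which makes it orthogonal, and the same determinant [gram u v], which gives
    determinant 1. *)
Lemma frame_rotation u v u' v' : cross u v != 0 ->
  dot u' u' = dot u u -> dot u' v' = dot u v -> dot v' v' = dot v v ->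
  exists A, [/\ rotation A, u *m A = u' & v *m A = v'].
Proof.
move=> uv0 huu huv hvv.
pose F := rows3 u v (cross u v); pose F' := rows3 u' v' (cross u' v').
have g0 := gram_gt0 uv0.
have dF : \det F = gram u v by rewrite det_rows3 gramE.
have dF' : \det F' = gram u v by rewrite det_rows3 -/(dot _ _) /trip -gramE /gram huu huv hvv.
have uF : F \in unitmx by rewrite unitmxE dF unitfE gt_eqF.
have FA : F *m (invmx F *m F') = F' by rewrite mulKVmx.
exists (invmx F *m F'); split; last 2 first.
- have := congr1 (row 0) FA; rewrite row_mul !row_rows3 eqxx //.
- have := congr1 (row 1) FA; rewrite row_mul !row_rows3 /=.
  by [].
split; last by rewrite det_mulmx det_inv dF dF' mulVf // gt_eqF.
have GF : F' *m F'^T = F *m F^T.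
  apply/matrixP => i j.
  have rc (G : 'M[R]_3) : (G *m G^T) i j = dot (row i G) (row j G).
    by rewrite !mxE; apply: eq_bigr => k _; rewrite !mxE.
  rewrite !rc !row_rows3.
  have uc x y : dot x (cross x y) = 0 by rewrite !coordE; ring.
  have vc x y : dot y (cross x y) = 0 by rewrite !coordE; ring.
  case: ifP => _; [|case: ifP => _]; (case: ifP => _; [|case: ifP => _]);
    rewrite -?gramE ?uc ?vc ?[dot (cross _ _) _]dotC ?uc ?vc /gram ?huu ?huv ?hvv //.
    by rewrite dotC huv dotC.
rewrite trmx_mul mulmxA -(mulmxA (invmx F)) GF mulmxA mulVmx // mul1mx.
by rewrite trmx_inv mulmxV // unitmx_tr.
Qed.

(** By [trip_gram] the product of [trip u v x] and [trip u v w] vanishes; the second factor cannot,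
    or [w] would be orthogonal to a whole frame. *)
Lemma coplanar_rel u v x w : cross u v != 0 -> w != 0 ->
  dot w u = 0 -> dot w v = 0 -> dot w x = 0 -> exists k l, x = k *: u + l *: v.
Proof.
move=> uv0 w0 wu wv wx; have g0 := lt0r_neq0 (gram_gt0 uv0).
have tx : trip u v x = 0.
  have := trip_gram u v x w.
  rewrite /gram [dot x w]dotC [dot v w]dotC [dot u w]dotC wu wv wx => /eqP.
  rewrite !mul0r subr0 addr0 mulf_eq0 => /orP[/eqP//|/eqP tw].
  case/eqP: w0; apply: (frame_inj uv0); rewrite ?(dotC 0) ?dot0r ?wu ?wv //.
  by rewrite tw /trip dot0r.
exists ((dot x u * dot v v - dot x v * dot u v) / gram u v),
  ((dot x v * dot u u - dot x u * dot u v) / gram u v).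
apply: (scalerI g0); rewrite frameE tx scale0r addr0 scalerDr !scalerA.
by congr (_ *: _ + _ *: _); field.
Qed.

End Vectors.

(** * Vectors with prescribed dot products and length *)

Section Solve.
Context {R : realType}.
Implicit Types (q r u v : R -> 'rV[R]_3) (f k : R -> R).

Definition radicalv q := forall i, radical (fun t => q t 0 i).

Lemma radicalv_cst (x : 'rV[R]_3) : radicalv (fun=> x).
Proof. by move=> i; exact: radical_cst. Qed.

Lemma radicalvD q r : radicalv q -> radicalv r -> radicalv (fun t => q t + r t).
Proof.
move=> rq rr i; apply: radical_ext (radicalD (rq i) (rr i)) _.
by near=> t; rewrite mxE.
Unshelve. all: by end_near. Qed.

Lemma radicalvZ k q : radical k -> radicalv q -> radicalv (fun t => k t *: q t).
Proof.
move=> rk rq i; apply: radical_ext (radicalM rk (rq i)) _.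
by near=> t; rewrite mxE.
Unshelve. all: by end_near. Qed.

Lemma radicalvB q r : radicalv q -> radicalv r -> radicalv (fun t => q t - r t).
Proof.
move=> rq rr i; apply: radical_ext (radicalB (rq i) (rr i)) _.
by near=> t; rewrite !mxE.
Unshelve. all: by end_near. Qed.

Lemma radicalv_cross q r : radicalv q -> radicalv r ->
  radicalv (fun t => cross (q t) (r t)).
Proof.
move=> rq rr i; apply: radical_ext (radicalB (radicalM (rq (i + 1)) (rr (i + 2%:R)))
  (radicalM (rq (i + 2%:R)) (rr (i + 1)))) _.
by near=> t; rewrite !mxE.
Unshelve. all: by end_near. Qed.

Lemma radicalv_dot q r : radicalv q -> radicalv r ->
  radical (fun t => dot (q t) (r t)).
Proof.
move=> rq rr.
apply: radical_ext (radicalD (radicalD (radicalM (rq 0) (rr 0)) (radicalM (rq 1) (rr 1)))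
  (radicalM (rq 2%:R) (rr 2%:R))) _.
by near=> t; rewrite dotE.
Unshelve. all: by end_near. Qed.

Lemma radicalv_gram q r : radicalv q -> radicalv r ->
  radical (fun t => gram (q t) (r t)).
Proof.
move=> rq rr; apply: radicalB; last by apply: radicalX; exact: radicalv_dot.
by apply: radicalM; exact: radicalv_dot.
Qed.

Lemma radicalv_trip q r u : radicalv q -> radicalv r -> radicalv u ->
  radical (fun t => trip (q t) (r t) (u t)).
Proof. by move=> ? ? ?; apply: radicalv_dot => //; exact: radicalv_cross. Qed.

Lemma dot_crossl (x y : 'rV[R]_3) : dot (cross x y) x = 0.
Proof. exact: trip_vvl. Qed.

Lemma dot_crossr (x y : 'rV[R]_3) : dot (cross x y) y = 0.
Proof. exact: trip_vvr. Qed.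

(** In the frame [u], [v], [cross u v] the two dot products fix the coordinates [L] and [M], and the
    length then fixes the square [S] of the triple product. Since [S 0 = T ^+ 2] is positive, its
    root exists near 0; the sign of [T] makes the solution start at [r0]. *)
Lemma radical_solve u v (al be rho : R -> R) (r0 : 'rV[R]_3) :
  radicalv u -> radicalv v -> radical al -> radical be -> radical rho ->
  trip (u 0) (v 0) r0 != 0 ->
  al 0 = dot r0 (u 0) -> be 0 = dot r0 (v 0) -> rho 0 = dot r0 r0 ->
  exists r, [/\ radicalv r, r 0 = r0 & \forall t \near (0 : R),
    [/\ dot (r t) (u t) = al t, dot (r t) (v t) = be t & dot (r t) (r t) = rho t]].
Proof.
move=> ru rv ral rbe rrho T0 al0 be0 rho0.
pose N t := gram (u t) (v t).
pose L t := al t * dot (v t) (v t) - be t * dot (u t) (v t).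
pose M t := be t * dot (u t) (u t) - al t * dot (u t) (v t).
pose S t := N t * rho t - L t * al t - M t * be t.
set T := trip (u 0) (v 0) r0 in T0.
have N0 : 0 < N 0 by apply/gram_gt0/trip_cross; exact: T0.
have S0 : S 0 = T ^+ 2.
  rewrite expr2 trip_gram /S /N /L /M /gram al0 be0 rho0 [dot (v 0) r0]dotC.
  by rewrite [dot (u 0) r0]dotC; ring.
have rN : radical N by exact: radicalv_gram.
have rL : radical L.
  by apply: radicalB; apply: radicalM => //; exact: radicalv_dot.
have rM : radical M.
  by apply: radicalB; apply: radicalM => //; exact: radicalv_dot.
have rS : radical S.
  by apply: radicalB; [apply: radicalB|]; exact: radicalM.
have S0p : 0 < S 0 by rewrite S0 exprn_even_gt0.
pose r t := (N t)^-1 *: (L t *: u t + M t *: v t +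
   (Num.sg T * Num.sqrt (S t)) *: cross (u t) (v t)).
exists r; split.
- apply: radicalvZ; first by apply: radicalV => //; rewrite gt_eqF.
  apply: radicalvD; first by apply: radicalvD; exact: radicalvZ.
  apply: radicalvZ; last exact: radicalv_cross.
  by apply: radicalM; [exact: radical_cst|exact: radical_sqrt].
- apply: (scalerI (lt0r_neq0 N0)); rewrite /r scalerA mulfV ?gt_eqF // scale1r.
  rewrite S0 sqrtr_sqr -numEsg frameE -/T /L /M al0 be0.
  by congr (_ *: _ + _ *: _ + _ *: _).
- have Np := continuous_near0_gt0 (radical_continuous rN) N0.
  have Sp := continuous_near0_gt0 (radical_continuous rS) S0p.
  near=> t.
  have Nt : N t != 0 by rewrite gt_eqF //; near: t.
  have St : Num.sqrt (S t) ^+ 2 = S t by rewrite sqr_sqrtr // ltW //; near: t.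
  have sg2 : Num.sg T ^+ 2 = 1 by rewrite sqr_sg T0.
  have ru_ : dot (r t) (u t) = al t.
    apply: (mulfI Nt); rewrite /r dotZl mulrA mulfV // mul1r !dot_lin dot_crossl.
    by rewrite [dot (v t) (u t)]dotC /L /M /N /gram; ring.
  have rv_ : dot (r t) (v t) = be t.
    apply: (mulfI Nt); rewrite /r dotZl mulrA mulfV // mul1r !dot_lin dot_crossr.
    by rewrite /L /M /N /gram; ring.
  have rc : dot (r t) (cross (u t) (v t)) = Num.sg T * Num.sqrt (S t).
    apply: (mulfI Nt); rewrite /r dotZl mulrA mulfV // mul1r !dot_lin.
    by rewrite ![dot _ (cross _ _)]dotC dot_crossl dot_crossr -gramE -/(N t); ring.
  split=> //; apply: (mulfI Nt).
  have -> x : dot x (r t) = (N t)^-1 * (L t * dot x (u t) + M t * dot x (v t) +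
      Num.sg T * Num.sqrt (S t) * dot x (cross (u t) (v t))).
    by rewrite dotZr !dotDr !dotZr.
  rewrite ru_ rv_ rc mulVKf // [_ * (Num.sg T * _)]mulrACA.
  by rewrite -!expr2 sg2 St /S; ring.
Unshelve. all: by end_near. Qed.

End Solve.

(** * The spherical linkage at a vertex *)

Section Vertex.
Context {R : realType}.
Implicit Types (a b c d u v x y : 'rV[R]_3).

Lemma sqr_sign_inj (k s t : R) : s * s = t * t -> 0 < k * s -> 0 < k * t -> s = t.
Proof.
move/eqP; rewrite -!expr2 eqf_sqr => /orP[/eqP//|/eqP ->].
by rewrite mulrN oppr_gt0 => /lt_trans h /h; rewrite ltxx.
Qed.

Definition gram3 (uu uv vv ux vx uy vy xy : R) : R :=
  xy * (uu * vv - uv ^+ 2) - vy * (uu * vx - uv * ux) + uy * (uv * vx - vv * ux).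

Lemma trip_gramE u v x y : trip u v x * trip u v y =
  gram3 (dot u u) (dot u v) (dot v v) (dot u x) (dot v x) (dot u y) (dot v y) (dot x y).
Proof. exact: trip_gram. Qed.

(* [a], [b], [c], [d] are the edges of a vertex in cyclic order, so that the
   faces are spanned by [a, b], [b, c], [c, d] and [d, a]; the condition on
   [c, d] is left out. *)
Definition vertex_gram a b c d a' b' c' d' : Prop :=
  [/\ dot a' a' = dot a a, dot b' b' = dot b b, dot c' c' = dot c c &
      dot d' d' = dot d d] /\
  [/\ dot a' b' = dot a b, dot b' c' = dot b c & dot d' a' = dot d a].

Definition vertex_sign a b c d a' b' c' d' : Prop :=
  [/\ 0 < trip a c b * trip a' c' b', 0 < trip a c d * trip a' c' d',
      0 < trip b d a * trip b' d' a' & 0 < trip b d c * trip b' d' c'].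

(** Each triple consists of an edge and its two neighbours, so its determinant is nonzero when the
    two faces that share the middle edge are not coplanar. *)
Definition vertex_nondeg a b c d : Prop :=
  [/\ trip a c b != 0, trip a c d != 0, trip b d a != 0 & trip b d c != 0].

(* [trip_gramE] with [x := b] and [y := d], solved for [dot b d]; its left-hand
   side is a square root of a known Gram polynomial, of unchanging sign. *)
Definition vertex_fun a b c d (s : R) : R :=
  let z := dot a c + s in
  let G x y := gram3 (dot a a) z (dot c c) (dot a x) (dot c x) (dot a y) (dot c y) in
  let T := trip a c b * trip a c d in
  (T * Num.sqrt (G b b (dot b b) * G d d (dot d d) / T ^+ 2) - G b d 0)
    / (dot a a * dot c c - z ^+ 2) - dot b d.

Lemma vertex_fun_radical a b c d : vertex_nondeg a b c d ->
  radical (vertex_fun a b c d).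
Proof.
move=> [t1 t2 _ _].
have rz : radical (fun s => dot a c + s).
  by apply: radicalD; [exact: radical_cst|exact: radical_id].
have rG x y k : radical (fun s => gram3 (dot a a) (dot a c + s) (dot c c)
    (dot a x) (dot c x) (dot a y) (dot c y) k).
  have rc := @radical_cst R.
  apply: radicalD; [apply: radicalB|]; apply: radicalM => //; apply: radicalB => //.
  - exact: radicalX.
  - exact: radicalM.
  - exact: radicalM.
apply: radicalB; last exact: radical_cst.
apply: radical_div; last 1 first.
- by rewrite addr0 gt_eqF // gram_gt0 // (trip_cross t1).
- apply: radicalB => //; apply: radicalM; first exact: radical_cst.
  apply: radical_sqrt.
    by apply: radicalM; [exact: radicalM|exact: radical_cst].
  rewrite addr0 -!trip_gramE -!expr2 -exprMn divr_gt0 //;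
    by rewrite exprn_even_gt0 //= mulf_neq0.
- by apply: radicalB; [exact: radical_cst|exact: radicalX].
Qed.

(** With [T] and [T'] the products of the two triple products before and after, the radicand is the
    square of [T' / T]. [vertex_sign] makes this quotient positive, so the root is [T' / T]
    itself. *)
Lemma vertex_funP a b c d a' b' c' d' : vertex_gram a b c d a' b' c' d' ->
  dot c' d' = dot c d -> vertex_sign a b c d a' b' c' d' ->
  dot b' d' - dot b d = vertex_fun a b c d (dot a' c' - dot a c).
Proof.
move=> [[aa bb cc dd] [ab bc da]] cd [s1 s2 _ _].
rewrite /vertex_fun; congr (_ - _); rewrite [dot a c + _]addrC subrK.
have t1 : trip a c b != 0 by apply: contraTneq s1 => ->; rewrite mul0r ltxx.
have t2 : trip a c d != 0 by apply: contraTneq s2 => ->; rewrite mul0r ltxx.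
have t1' : trip a' c' b' != 0 by apply: contraTneq s1 => ->; rewrite mulr0 ltxx.
have N0 : gram a' c' != 0 by rewrite gt_eqF // gram_gt0 // (trip_cross t1').
rewrite -aa -cc -/(gram a' c').
apply: (mulIf N0); rewrite divfK //.
have cb : dot c' b' = dot c b by rewrite dotC bc dotC.
have ad : dot a' d' = dot a d by rewrite dotC da dotC.
rewrite -bb -dd -ab -cb -ad -cd -!trip_gramE.
set T := trip a c b * trip a c d; set T' := trip a' c' b' * trip a' c' d'.
have T0 : T != 0 by rewrite mulf_neq0.
have -> : trip a' c' b' * trip a' c' b' * (trip a' c' d' * trip a' c' d') / T ^+ 2
   = (T' / T) ^+ 2 by rewrite /T'; field.
rewrite sqrtr_sqr ger0_norm; last first.
  have -> : T' / T = (trip a c b * trip a' c' b') * (trip a c d * trip a' c' d') / T ^+ 2.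
    by rewrite /T' /T; field; apply/andP; split.
  by apply: divr_ge0; [apply: mulr_ge0; exact: ltW|exact: sqr_ge0].
rewrite [T * _]mulrC divfK //.
by rewrite /T' trip_gramE /gram3 /gram; ring.
Qed.

Lemma vertex_fun0 a b c d : vertex_nondeg a b c d -> vertex_fun a b c d 0 = 0.
Proof.
move=> [t1 t2 t3 t4]; have := @vertex_funP a b c d a b c d.
rewrite !subrr => <- //.
by split; rewrite -expr2 exprn_even_gt0.
Qed.

Lemma vertex_swap_nondeg a b c d : vertex_nondeg a b c d -> vertex_nondeg b a d c.
Proof. by move=> [t1 t2 t3 t4]; split. Qed.

(** Exchanging [a] with [b] and [c] with [d] reverses the cyclic order and is a symmetry of the
    linkage, so the inverse dependence is given by the same formula. *)
Lemma vertex_funP_swap a b c d a' b' c' d' : vertex_gram a b c d a' b' c' d' ->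
  dot c' d' = dot c d -> vertex_sign a b c d a' b' c' d' ->
  dot a' c' - dot a c = vertex_fun b a d c (dot b' d' - dot b d).
Proof.
move=> [[aa bb cc dd] [ab bc da]] cd [s1 s2 s3 s4]; apply: vertex_funP => //.
- by split; split=> //; rewrite dotC ?ab ?bc ?da dotC.
- by rewrite dotC cd dotC.
Qed.

(** The edges [a] and [b] stay fixed. [c] is solved for with the prescribed product with [a], then
    [d] from its products with [a] and the new [c]; the orientations persist by continuity. *)
Lemma vertex_exists a b c d : vertex_nondeg a b c d ->
  \forall s \near (0 : R), exists a' b' c' d',
  [/\ vertex_gram a b c d a' b' c' d', dot c' d' = dot c d,
      vertex_sign a b c d a' b' c' d' & dot a' c' - dot a c = s].
Proof.
move=> [t1 t2 t3 t4].
have rc := @radical_cst R; have rvc := @radicalv_cst R.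
have tabc : trip a b c != 0 by rewrite -trip_rot trip_swap oppr_eq0 trip_rot in t1 *.
have [c' [rc' c0 hc]] : exists c' : R -> 'rV[R]_3, [/\ radicalv c', c' 0 = c &
   \forall s \near (0 : R), [/\ dot (c' s) a = dot a c + s, dot (c' s) b = dot c b
     & dot (c' s) (c' s) = dot c c]].
  apply: (@radical_solve R (fun=> a) (fun=> b)) => //.
    by apply: radicalD; [exact: rc|exact: radical_id].
  by rewrite addr0 dotC.
have [d' [rd' d0 hd]] : exists d' : R -> 'rV[R]_3, [/\ radicalv d', d' 0 = d &
   \forall s \near (0 : R), [/\ dot (d' s) a = dot d a, dot (d' s) (c' s) = dot d c
     & dot (d' s) (d' s) = dot d d]].
  by apply: (@radical_solve R (fun=> a) c'); rewrite ?c0.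
have pos (f : R -> R) : radical f -> f 0 != 0 -> \forall s \near (0 : R), 0 < f 0 * f s.
  move=> rf f0; apply: (@continuous_near0_gt0 _ (fun s => f 0 * f s)).
    by apply: radical_continuous; exact: radicalM.
  by rewrite -expr2 exprn_even_gt0.
have p1 := pos _ (radicalv_trip (rvc a) rc' (rvc b)).
have p2 := pos _ (radicalv_trip (rvc a) rc' rd').
have p3 := pos _ (radicalv_trip (rvc b) rd' (rvc a)).
have p4 := pos _ (radicalv_trip (rvc b) rd' rc').
rewrite /= c0 d0 in p1 p2 p3 p4.
near=> s; exists a, b, (c' s), (d' s).
have [ca cb cc] : [/\ dot (c' s) a = dot a c + s, dot (c' s) b = dot c b
     & dot (c' s) (c' s) = dot c c] by near: s.
have [da dc dd] : [/\ dot (d' s) a = dot d a, dot (d' s) (c' s) = dot d c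
     & dot (d' s) (d' s) = dot d d] by near: s.
split.
- by split; split=> //; rewrite dotC cb dotC.
- by rewrite dotC dc dotC.
- by split; near: s; [exact: p1|exact: p2|exact: p3|exact: p4].
- by rewrite dotC ca addrC addKr.
Unshelve. all: by end_near. Qed.

(** Every small [s] is realized by an actual linkage, to which both formulas apply; no derivative
    has to be inspected. *)
Lemma vertex_fun_swapK a b c d : vertex_nondeg a b c d ->
  \forall s \near (0 : R), vertex_fun b a d c (vertex_fun a b c d s) = s.
Proof.
move=> /vertex_exists ex; near=> s.
have [a' [b' [c' [d' [vg cd vs <-]]]]] : exists a' b' c' d',
  [/\ vertex_gram a b c d a' b' c' d', dot c' d' = dot c d,
      vertex_sign a b c d a' b' c' d' & dot a' c' - dot a c = s] by near: s.
by rewrite -(vertex_funP vg cd vs) -(vertex_funP_swap vg cd vs).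
Unshelve. all: by end_near. Qed.

(* Fitting the fourth face of a vertex: the model of [vertex_exists] with the
   same opposite angles has the same Gram matrix as [a', b', c', d']. *)
Lemma vertex_closing a b c d : vertex_nondeg a b c d ->
  \forall s \near (0 : R), forall a' b' c' d',
    vertex_gram a b c d a' b' c' d' -> vertex_sign a b c d a' b' c' d' ->
    dot a' c' - dot a c = s -> dot b' d' - dot b d = vertex_fun a b c d s ->
    dot c' d' = dot c d.
Proof.
move=> /vertex_exists ex; near=> s => a' b' c' d' vg' vs' ac' bd'.
have [a2 [b2 [c2 [d2 [vg cd vs ac]]]]] : exists a' b' c' d',
  [/\ vertex_gram a b c d a' b' c' d', dot c' d' = dot c d,
      vertex_sign a b c d a' b' c' d' & dot a' c' - dot a c = s] by near: s.
have bd := vertex_funP vg cd vs; rewrite ac -bd' in bd.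
move: vg vs vg' vs' => [[aa bb cc dd] [ab bc da]] [s1 _ s3 _].
move=> [[aa' bb' cc' dd'] [ab' bc' da']] [s1' _ s3' _].
have acE : dot a' c' = dot a2 c2 by apply: (addIr (- dot a c)); rewrite ac' ac.
have bdE : dot b' d' = dot b2 d2 by apply: (addIr (- dot b d)); rewrite bd.
have abc x y z : trip x y z = - trip x z y by rewrite trip_swap trip_rot.
(* The squares of these triple products are Gram polynomials in products already matched, and the
   orientation selects the root. [trip_gram] then yields the one product still unknown. *)
have tc : trip a' b' c' = trip a2 b2 c2.
  apply: (@sqr_sign_inj (- trip a c b)).
  - by rewrite !trip_gramE aa aa' ab ab' bb bb' bc bc' cc cc' acE.
  - by rewrite (abc a') mulrNN.
  - by rewrite (abc a2) mulrNN.
have td : trip a' b' d' = trip a2 b2 d2.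
  apply: (@sqr_sign_inj (trip b d a)).
  - by rewrite !trip_gramE aa aa' ab ab' bb bb' dd dd' bdE ![dot _ d']dotC ![dot _ d2]dotC da da'.
  - by rewrite (trip_rot a').
  - by rewrite (trip_rot a2).
have g0 : gram a2 b2 != 0.
  rewrite gt_eqF // gram_gt0 //; apply: (@trip_cross _ _ _ d2).
  by rewrite trip_rot; apply: contraTneq s3 => ->; rewrite mulr0 ltxx.
have da2 : dot a' d' = dot a2 d2 by rewrite dotC da' -da dotC.
have e := trip_gram a' b' c' d'; rewrite tc td trip_gram in e.
rewrite -cd; apply: (mulIf g0); move: e.
rewrite /gram bdE acE da2 aa' ab' bb' bc' aa ab bb bc => e.
lra.
Unshelve. all: by end_near. Qed.

End Vertex.

(** * Nets indexed by natural numbers *)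

Section Grid.
Context {R : realType}.
Implicit Types (p q : nat -> nat -> 'rV[R]_3) (A B : nat -> nat -> R).

Definition tr (T : Type) (f : nat -> nat -> T) i j := f j i.

Definition dn p i j := p i.+1 j - p i j.
Definition rt p i j := p i j.+1 - p i j.

(* [p] is a conjugate net with prescribed planar faces: the coefficients [A, B]
   are invariant under rigid motions of the face. *)
Definition face_rel A B p i j : Prop :=
  p i.+1 j.+1 - p i j = A i j *: dn p i j + B i j *: rt p i j.

Lemma face_rel_tr A B p i j :
  face_rel A B p i j -> face_rel (tr B) (tr A) (tr p) j i.
Proof. by move=> r; rewrite /face_rel [RHS]addrC; exact: r. Qed.

Lemma face_relE A B p i j : face_rel A B p i j ->
  p i.+1 j.+1 = p i j + (A i j *: dn p i j + B i j *: rt p i j).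
Proof. by move=> <-; rewrite addrC subrK. Qed.

Lemma rt_next A B p i j : face_rel A B p i j ->
  rt p i.+1 j = (A i j - 1) *: dn p i j + B i j *: rt p i j.
Proof.
by move=> /face_relE; rewrite /rt /dn => ->; apply/rowP => k; rewrite !mxE; ring.
Qed.

Lemma dn_next A B p i j : face_rel A B p i j ->
  dn p i j.+1 = A i j *: dn p i j + (B i j - 1) *: rt p i j.
Proof.
by move=> /face_relE; rewrite /rt /dn => ->; apply/rowP => k; rewrite !mxE; ring.
Qed.

(** The left side is eliminated in favour of the right one, which is the hinge to the next face. *)
Lemma rt_below A B p i j : face_rel A B p i j -> A i j != 0 ->
  rt p i.+1 j = ((A i j - 1) / A i j) *: dn p i j.+1
              + ((A i j + B i j - 1) / A i j) *: rt p i j.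
Proof.
move=> r A0; rewrite (rt_next r) (dn_next r).
by apply/rowP => k; rewrite !mxE; field.
Qed.

Definition face_gram p q i j : Prop :=
  [/\ dot (dn q i j) (dn q i j) = dot (dn p i j) (dn p i j),
      dot (rt q i j) (rt q i j) = dot (rt p i j) (rt p i j) &
      dot (dn q i j) (rt q i j) = dot (dn p i j) (rt p i j)].

(** When the face of [p] has the coefficients [A], [B] and a nondegenerate first corner, this is
    congruence of the two faces by a rigid motion. *)
Definition face_iso A B p q i j : Prop := face_rel A B q i j /\ face_gram p q i j.

Lemma face_iso_tr A B p q i j :
  face_iso A B p q i j -> face_iso (tr B) (tr A) (tr p) (tr q) j i.
Proof.
move=> [r [g1 g2 g3]]; split; first exact: face_rel_tr.
by split=> //; rewrite /dn /rt /tr /= dotC -/(dn q i j) -/(rt q i j) g3 dotC.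
Qed.

Lemma face_iso_edges A B p q i j : face_rel A B p i j -> face_iso A B p q i j ->
  [/\ dot (dn q i j.+1) (dn q i j.+1) = dot (dn p i j.+1) (dn p i j.+1),
      dot (rt q i.+1 j) (rt q i.+1 j) = dot (rt p i.+1 j) (rt p i.+1 j) &
      dot (dn q i j.+1) (rt q i.+1 j) = dot (dn p i j.+1) (rt p i.+1 j)] /\
  [/\ dot (rt q i j) (dn q i j.+1) = dot (rt p i j) (dn p i j.+1) &
      dot (rt q i.+1 j) (dn q i j) = dot (rt p i.+1 j) (dn p i j)].
Proof.
move=> rp [rq [g1 g2 g3]]; rewrite !(rt_next rp) !(rt_next rq) !(dn_next rp) !(dn_next rq).
have g4 : dot (rt q i j) (dn q i j) = dot (rt p i j) (dn p i j).
  by rewrite dotC g3 dotC.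
move: (dn q i j) (rt q i j) (dn p i j) (rt p i j) g1 g2 g3 g4 => a b a' b' g1 g2 g3 g4.
by split; split; rewrite !dot_lin ?g1 ?g2 ?g3 ?g4.
Qed.

Definition hdot p i j := dot (rt p i j) (rt p i j.+1).
Definition vdot p i j := dot (dn p i j) (dn p i.+1 j).

(** The coefficient of the upper edge in the lower edge right of the hinge ([rt_next]), times the
    one left of it ([rt_below]). *)
Definition ratio A B i j := B i j.+1 * ((A i j + B i j - 1) / A i j).

(** Once the lower edges are expressed by the hinge and the upper edges, every product involving the
    hinge lies within one face and is unchanged; only the product of the upper edges contributes. *)
Lemma hdot_step A B p q i j :
  face_rel A B p i j -> face_rel A B p i j.+1 -> A i j != 0 ->
  face_iso A B p q i j -> face_iso A B p q i j.+1 ->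
  hdot q i.+1 j - hdot p i.+1 j = ratio A B i j * (hdot q i j - hdot p i j).
Proof.
move=> r1 r2 A0 i1 i2.
have [[e1 _ _] [e2 _]] := face_iso_edges r1 i1.
have [q1 _] := i1; have [q2 [f1 f2 f3]] := i2.
rewrite /hdot (rt_below r1 A0) (rt_below q1 A0) (rt_next r2) (rt_next q2) /ratio.
move: e1 e2 f3; move: (dn q i j.+1) (rt q i j) (rt q i j.+1).
move: (dn p i j.+1) (rt p i j) (rt p i j.+1) => a b c a' b' c' e1 e2 f3.
by rewrite !dot_lin e1 e2 f3; ring.
Qed.

(** Terms containing the hinge twice vanish, which leaves the same factor as in [hdot_step]. This
    carries noncoplanarity from the upper end of a hinge to its lower end. *)
Lemma trip_step A B p i j :
  face_rel A B p i j -> face_rel A B p i j.+1 -> A i j != 0 ->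
  trip (rt p i.+1 j) (dn p i j.+1) (rt p i.+1 j.+1) =
  ratio A B i j * trip (rt p i j) (dn p i j.+1) (rt p i j.+1).
Proof.
move=> r1 r2 A0; rewrite (rt_below r1 A0) (rt_next r2) /ratio.
move: (dn p i j.+1) (rt p i j) (rt p i j.+1) => a b c.
rewrite trip_addl !trip_scalel !trip_addr !trip_scaler !trip_vvr.
have -> x y : trip x x y = 0 :> R by rewrite trip_rot trip_vvl.
by ring.
Qed.

(* [m] and [n] count the rows and columns of faces *)
Record regular m n A B p : Prop := Regular {
  reg_rel : forall i j, (i < m)%N -> (j < n)%N -> face_rel A B p i j;
  reg_A : forall i j, (i < m)%N -> (j < n)%N -> A i j != 0;
  reg_B : forall i j, (i < m)%N -> (j < n)%N -> B i j != 0;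
  reg_AB : forall i j, (i < m)%N -> (j < n)%N -> A i j + B i j != 1;
  reg_cross : forall i j, (i < m)%N -> (j < n)%N -> cross (dn p i j) (rt p i j) != 0;
  reg_h : forall i j, (i < m)%N -> (j.+1 < n)%N ->
    trip (rt p i j) (dn p i j.+1) (rt p i j.+1) != 0;
  reg_v : forall i j, (i.+1 < m)%N -> (j < n)%N ->
    trip (dn p i j) (rt p i.+1 j) (dn p i.+1 j) != 0 }.

Lemma crossN (u v : 'rV[R]_3) : cross u v = - cross v u.
Proof. by apply/rowP => i; rewrite !mxE; ring. Qed.

Lemma regular_tr m n A B p : regular m n A B p ->
  regular n m (tr B) (tr A) (tr p).
Proof.
move=> [r1 r2 r3 r4 r5 r6 r7]; split=> i j hi hj.
- by apply: face_rel_tr; exact: r1.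
- exact: r3.
- exact: r2.
- by rewrite addrC; exact: r4.
- by rewrite crossN oppr_eq0; exact: r5.
- exact: r7.
- exact: r6.
Qed.

(* By [hdot_step], dividing the change of [hdot] by [scale] makes it constant
   along a column; it then parametrizes all hinges of that column at once. *)
Definition scale A B i j := \prod_(k < i) ratio A B k j.

Definition hpar A B p q i j := (hdot q i j - hdot p i j) / scale A B i j.
Definition vpar A B p q i j := hpar (tr B) (tr A) (tr p) (tr q) j i.

Section Regular.
Variables (m n : nat) (A B : nat -> nat -> R) (p : nat -> nat -> 'rV[R]_3).
Hypothesis reg : regular m n A B p.

Lemma ratio_neq0 i j : (i < m)%N -> (j.+1 < n)%N -> ratio A B i j != 0.
Proof.
move=> im jn; have jn' := ltnW jn.
rewrite !mulf_neq0 ?invr_neq0 ?(reg_A reg) ?(reg_B reg) //.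
by rewrite subr_eq0 (reg_AB reg).
Qed.

Lemma scale_neq0 i j : (i <= m)%N -> (j.+1 < n)%N -> scale A B i j != 0.
Proof.
move=> im jn; apply/prodf_neq0 => k _; apply: ratio_neq0 => //.
exact: leq_trans im.
Qed.

Lemma hpar_step q i j : (i < m)%N -> (j.+1 < n)%N ->
  face_iso A B p q i j -> face_iso A B p q i j.+1 ->
  hpar A B p q i.+1 j = hpar A B p q i j.
Proof.
move=> im jn i1 i2; have jn' := ltnW jn.
have [r1 r2] := (reg_rel reg im jn', reg_rel reg im jn).
rewrite /hpar (hdot_step r1 r2 _ i1 i2) ?(reg_A reg) //.
rewrite /scale big_ord_recr /= -/(scale A B i j) invfM mulrACA.
have r0 := ratio_neq0 im jn; have s0 := scale_neq0 (ltnW im) jn.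
by field; rewrite r0 s0.
Qed.

End Regular.

End Grid.

(** * Hinge parameters at an interior vertex *)

Section Vertices.
Context {R : realType}.
Variables (m n : nat) (A B : nat -> nat -> R) (p : nat -> nat -> 'rV[R]_3).
Hypothesis reg : regular m n A B p.
Implicit Types q : nat -> nat -> 'rV[R]_3.

Lemma vpar_step q i j : (i.+1 < m)%N -> (j < n)%N ->
  face_iso A B p q i j -> face_iso A B p q i.+1 j ->
  vpar A B p q i j.+1 = vpar A B p q i j.
Proof.
move=> im jn i1 i2; apply: (hpar_step (regular_tr reg)) => //; exact: face_iso_tr.
Qed.

Definition vscale i j := scale (tr B) (tr A) j i.

Lemma vscale_neq0 i j : (i.+1 < m)%N -> (j <= n)%N -> vscale i j != 0.
Proof. by move=> im jn; apply: (scale_neq0 (regular_tr reg)). Qed.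

(* The edges at the interior vertex [p i.+1 j.+1] in the order up, left, down,
   right; the first two point towards the vertex. *)
Definition at_vertex (T : Type) (F : 'rV[R]_3 -> 'rV[R]_3 -> 'rV[R]_3 -> 'rV[R]_3 -> T) q i j :=
  F (dn q i j.+1) (rt q i.+1 j) (dn q i.+1 j.+1) (rt q i.+1 j.+1).

(** The vertex is the upper or left end of the hinges below and to the right, where [reg_h] and
    [reg_v] apply; it is the lower or right end of the other two, which [trip_step] reaches. *)
Lemma vertex_nondegP i j : (i.+1 < m)%N -> (j.+1 < n)%N ->
  at_vertex vertex_nondeg p i j.
Proof.
move=> im jn; have im' := ltnW im; have jn' := ltnW jn.
have sw (x y z : 'rV[R]_3) : trip x z y = - trip x y z.
  by rewrite trip_swap trip_rot trip_rot.
split; rewrite sw oppr_eq0.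
- have := @trip_step R (tr B) (tr A) (tr p) j i.
  rewrite /dn /rt /tr => ->; last 3 first.
  + by apply: face_rel_tr; exact: (reg_rel reg).
  + by apply: face_rel_tr; exact: (reg_rel reg).
  + exact: (reg_B reg).
  rewrite mulf_neq0 //; first exact: (ratio_neq0 (regular_tr reg)).
  exact: (reg_h (regular_tr reg)).
- exact: (reg_v reg).
- have [r1 r2] := (reg_rel reg im' jn', reg_rel reg im' jn).
  rewrite (trip_step r1 r2) ?(reg_A reg) // mulf_neq0 //.
    exact: (ratio_neq0 reg).
  exact: (reg_h reg).
- exact: (reg_h reg).
Qed.

(** [vertex_fun] in the normalized parameters of the two crossing lines: [vscale] turns the row
    parameter into a change of dot product at this vertex, and [scale] normalizes the resulting
    change for the column line. *)
Definition transfer i j (x : R) : R :=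
  at_vertex vertex_fun p i j (vscale i j.+1 * x) / scale A B i.+1 j.
Definition transferV i j (y : R) : R :=
  at_vertex (fun a b c d => vertex_fun b a d c) p i j (scale A B i.+1 j * y) / vscale i j.+1.

Definition vsign q i j := at_vertex (at_vertex vertex_sign p i j) q i j.

Section OneVertex.
Variables i j : nat.
Hypotheses (im : (i.+1 < m)%N) (jn : (j.+1 < n)%N).

Let ND := vertex_nondegP im jn.
Let s0 : scale A B i.+1 j != 0. Proof. by apply: (scale_neq0 reg) => //; exact: ltnW. Qed.
Let v0 : vscale i j.+1 != 0. Proof. by apply: vscale_neq0 => //; exact: ltnW. Qed.

Let radical_scale (c : R) : radical (fun x : R => c * x).
Proof. by apply: radicalM; [exact: radical_cst|exact: radical_id]. Qed.

Lemma transfer_radical : radical (transfer i j).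
Proof.
apply: radicalM; last exact: radical_cst.
by apply: radical_comp; [exact: vertex_fun_radical|exact: radical_scale|rewrite mulr0].
Qed.

Lemma transferV_radical : radical (transferV i j).
Proof.
apply: radicalM; last exact: radical_cst.
apply: radical_comp; [|exact: radical_scale|by rewrite mulr0].
by apply: vertex_fun_radical; exact: vertex_swap_nondeg.
Qed.

Lemma transfer0 : transfer i j 0 = 0.
Proof. by rewrite /transfer mulr0 [at_vertex _ _ _ _ _]vertex_fun0 // mul0r. Qed.

Lemma transferV0 : transferV i j 0 = 0.
Proof.
rewrite /transferV mulr0 [at_vertex _ _ _ _ _]vertex_fun0 ?mul0r //.
exact: vertex_swap_nondeg.
Qed.

Let near_scale (c : R) (P : R -> Prop) : (\forall t \near (0 : R), P t) ->
  \forall t \near (0 : R), P (c * t).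
Proof.
by apply: near0_comp; [apply: radical_continuous; exact: radical_scale|rewrite mulr0].
Qed.

Lemma transferK : \forall x \near (0 : R), transferV i j (transfer i j x) = x.
Proof.
have h := near_scale (vscale i j.+1) (vertex_fun_swapK ND); near=> x.
rewrite /transferV /transfer [_ * (_ / _)]mulrC divfK //.
by rewrite [X in X / _](near h x) // mulrC mulKf.
Unshelve. all: by end_near. Qed.

Lemma transferVK : \forall y \near (0 : R), transfer i j (transferV i j y) = y.
Proof.
have h := near_scale (scale A B i.+1 j) (vertex_fun_swapK (vertex_swap_nondeg ND)).
near=> x.
rewrite /transferV /transfer [_ * (_ / _)]mulrC divfK //.
by rewrite [X in X / _](near h x) // mulrC mulKf.
Unshelve. all: by end_near. Qed.

(** These three faces contribute the edge pairs up-left, right-up and left-down. The pair down-right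
    belongs to the fourth face, whose congruence is thus left open for [transfer_closing]. *)
Lemma face_iso_vertex q : face_iso A B p q i j -> face_iso A B p q i j.+1 ->
  face_iso A B p q i.+1 j ->
  at_vertex (at_vertex vertex_gram p i j) q i j.
Proof.
have im' := ltnW im; have jn' := ltnW jn.
move=> i1 i2 i3.
have [[e1 e2 e3] _] := face_iso_edges (reg_rel reg im' jn') i1.
have [[_ f2 _] [_ f5]] := face_iso_edges (reg_rel reg im' jn) i2.
have [[g1 _ _] [g4 _]] := face_iso_edges (reg_rel reg im jn') i3.
by [].
Qed.

Lemma hdotE q : hdot q i.+1 j - hdot p i.+1 j = scale A B i.+1 j * hpar A B p q i.+1 j.
Proof. by rewrite /hpar mulrC divfK. Qed.

Lemma vdot_vparE q : vdot q i j.+1 - vdot p i j.+1 = vscale i j.+1 * vpar A B p q i j.+1.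
Proof. by rewrite /vpar /hpar -/(vscale _ _) mulrC divfK. Qed.

Lemma transferP q : face_iso A B p q i j -> face_iso A B p q i j.+1 ->
  face_iso A B p q i.+1 j -> face_iso A B p q i.+1 j.+1 -> vsign q i j ->
  hpar A B p q i.+1 j = transfer i j (vpar A B p q i j.+1) /\
  vpar A B p q i j.+1 = transferV i j (hpar A B p q i.+1 j).
Proof.
move=> i1 i2 i3 [_ [_ _ cd]] vs; have vg := face_iso_vertex i1 i2 i3.
have h := vertex_funP vg cd vs; have v := vertex_funP_swap vg cd vs.
split.
- rewrite /transfer -vdot_vparE; by apply: (mulIf s0); rewrite [RHS]divfK // [LHS]mulrC -hdotE.
- rewrite /transferV -hdotE; by apply: (mulIf v0); rewrite [RHS]divfK // [LHS]mulrC -vdot_vparE.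
Qed.

Lemma transfer_closing : \forall x \near (0 : R), forall q,
  face_iso A B p q i j -> face_iso A B p q i j.+1 ->
  face_iso A B p q i.+1 j -> face_rel A B q i.+1 j.+1 -> vsign q i j ->
  vpar A B p q i j.+1 = x -> hpar A B p q i.+1 j = transfer i j x ->
  face_iso A B p q i.+1 j.+1.
Proof.
have h := near_scale (vscale i j.+1) (vertex_closing ND); near=> x.
move=> q i1 i2 i3 r4 vs vx hx; have vg := face_iso_vertex i1 i2 i3.
have cd : dot (dn q i.+1 j.+1) (rt q i.+1 j.+1) = dot (dn p i.+1 j.+1) (rt p i.+1 j.+1).
  apply: (near h x _ _ _ _ _ vg vs) => //.
    by rewrite -vx -vdot_vparE.
  rewrite -[LHS]/(hdot q i.+1 j - hdot p i.+1 j) hdotE hx /transfer.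
  by rewrite mulrC divfK.
split=> //; split=> //.
- by have [[]] := vg.
- by have [[]] := vg.
Unshelve. all: by end_near. Qed.

End OneVertex.

End Vertices.

(** * Flexible 3 x 3 windows *)

Section Continuity.
Context {R : realType}.

(** The supremum of the [t] in the unit interval with [Z (t * s1) = 0] gives the last zero on the
    way from 0 to [s1]; scaling [s1] treats both of its signs at once. A deformation may begin with
    a whole interval of congruent positions, so 0 itself would not do. *)
Lemma last_zero (Z : R -> R) (e s1 : R) : 0 < e ->
  (forall s, - e < s < e -> {for s, continuous Z}) -> Z 0 = 0 ->
  - e < s1 < e -> Z s1 != 0 ->
  exists s0, [/\ - e < s0 < e, Z s0 = 0 & forall P : R -> Prop,
    (\forall s \near s0, P s) -> exists s, [/\ - e < s < e, Z s != 0 & P s]].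
Proof.
move=> e0 cZ Z0 s1e Zs1.
have sub t : 0 <= t <= 1 -> - e < t * s1 < e.
  by move=> t01; apply/andP; split; nra.
pose S := [set t : R | 0 <= t <= 1 /\ Z (t * s1) = 0].
have S0 : S 0 by split; [rewrite lexx ler01|rewrite mul0r].
have supS : has_sup S by split; [exists 0|exists 1 => t [/andP[]]].
pose t0 := sup S.
have t01 : 0 <= t0 <= 1.
  apply/andP; split; first by apply: ub_le_sup => //; case: supS.
  by apply: ge_sup; [exists 0|move=> t [/andP[]]].
have cs : {for t0, continuous (fun t : R => t * s1)} by apply: cvgM; [exact: cvg_id|exact: cvg_cst].
have cZs : {for t0, continuous (fun t : R => Z (t * s1))}.
  by apply: (@continuous_comp R R R (fun t : R => t * s1) Z); [exact: cs|exact: cZ (sub _ t01)].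
have Zt0 : Z (t0 * s1) = 0.
  apply/eqP/negPn/negP => n0.
  have hn : nbhs (Z (t0 * s1)) [set y | y != 0].
    by apply: open_nbhs_nbhs; split=> //; exact: open_neq.
  have /nbhs_ballP[d /= d0 hd] := cZs _ hn.
  have [t [tS ts] tgt] := sup_adherent d0 supS.
  have tle : t <= t0 by apply: ub_le_sup => //; case: supS.
  have : Z (t * s1) != 0.
    apply: hd; rewrite /ball /= ger0_norm ?subr_ge0 //; rewrite -/t0 in tgt; lra.
  by rewrite ts eqxx.
have t0lt : t0 < 1.
  rewrite lt_neqAle (andP t01).2 andbT; apply/eqP => t0E.
  by move: Zt0 Zs1; rewrite t0E mul1r => ->; rewrite eqxx.
exists (t0 * s1); split=> [|//|P nP]; first exact: sub.
have /nbhs_ballP[d /= d0 hd] := cs _ nP.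
pose t := Num.min 1 (t0 + d / 2).
have [h1 h2 h3] : [/\ t0 < t, t <= 1 & t <= t0 + d / 2].
  by rewrite /t; case: (lerP 1 (t0 + d / 2)) => ?; split; lra.
have t01' : 0 <= t <= 1 by apply/andP; split => //; move/andP: t01 => [? ?]; lra.
exists (t * s1); split; first exact: sub.
- apply/eqP => Zt; suff : t <= t0 by lra.
  by apply: ub_le_sup => //; case: supS.
- by apply: hd; rewrite /ball /= ltr0_norm; lra.
Qed.

Definition cvrow (q : R -> 'rV[R]_3) s := forall i, {for s, continuous (fun t => q t 0 i)}.

Lemma cvrowB q r s : cvrow q s -> cvrow r s -> cvrow (fun t => q t - r t) s.
Proof.
move=> cq cr i.
have -> : (fun t => (q t - r t) 0 i) = (fun t => q t 0 i - r t 0 i).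
  by apply/funext => t; rewrite !mxE.
by apply: cvgB; [exact: cq|exact: cr].
Qed.

Lemma cvrow_dot q r s : cvrow q s -> cvrow r s -> {for s, continuous (fun t => dot (q t) (r t))}.
Proof.
move=> cq cr.
have -> : (fun t => dot (q t) (r t)) = (fun t => q t 0 0 * r t 0 0 + q t 0 1 * r t 0 1
    + q t 0 2%:R * r t 0 2%:R).
  by apply/funext => t; rewrite dotE.
apply: cvgD; [apply: cvgD|]; apply: cvgM;
  [exact: cq|exact: cr|exact: cq|exact: cr|exact: cq|exact: cr].
Qed.

Lemma cvrow_trip q r u s : cvrow q s -> cvrow r s -> cvrow u s ->
  {for s, continuous (fun t => trip (q t) (r t) (u t))}.
Proof.
move=> cq cr cu; apply: cvrow_dot => // i.
have -> : (fun t => cross (q t) (r t) 0 i) = (fun t =>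
    q t 0 (i + 1) * r t 0 (i + 2%:R) - q t 0 (i + 2%:R) * r t 0 (i + 1)).
  by apply/funext => t; rewrite !mxE.
by apply: cvgB; apply: cvgM; [exact: cq|exact: cr|exact: cq|exact: cr].
Qed.

End Continuity.

(** * Deviation of a vertex from a congruent copy *)

Section Defect.
Context {R : realType}.
Implicit Types (a b c d u v x : 'rV[R]_3).

(** Equal dot products alone would allow a different branch of the linkage. The triple products are
    included so that a zero means congruence even where the orientations are not known. *)
Definition vertex_defect a b c d a' b' c' d' : R :=
  (dot a' c' - dot a c) ^+ 2 + (dot b' d' - dot b d) ^+ 2
  + (trip a' c' b' - trip a c b) ^+ 2 + (trip a' c' d' - trip a c d) ^+ 2
  + (trip b' d' a' - trip b d a) ^+ 2 + (trip b' d' c' - trip b d c) ^+ 2.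

Lemma vertex_defect_ge0 a b c d a' b' c' d' : 0 <= vertex_defect a b c d a' b' c' d'.
Proof. by rewrite !addr_ge0 // sqr_ge0. Qed.

Lemma vertex_defect_xx a b c d : vertex_defect a b c d a b c d = 0.
Proof. by rewrite /vertex_defect !subrr expr0n !addr0. Qed.

Lemma vertex_defect_eq0 a b c d a' b' c' d' : vertex_defect a b c d a' b' c' d' = 0 ->
  [/\ dot a' c' = dot a c & dot b' d' = dot b d] /\
  [/\ trip a' c' b' = trip a c b, trip a' c' d' = trip a c d,
      trip b' d' a' = trip b d a & trip b' d' c' = trip b d c].
Proof.
move/eqP; rewrite /vertex_defect.
rewrite !paddr_eq0 ?addr_ge0 ?sqr_ge0 // !sqrf_eq0 !subr_eq0 -!andbA.
by case/and5P=> /eqP ? /eqP ? /eqP ? /eqP ? /andP[/eqP ? /eqP ?].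
Qed.

(** Where the orientations are known, [trip_gramE] determines the triple products from the dot
    products. *)
Lemma vertex_defect_small a b c d a' b' c' d' : vertex_nondeg a b c d ->
  vertex_gram a b c d a' b' c' d' -> dot c' d' = dot c d ->
  vertex_sign a b c d a' b' c' d' ->
  dot a' c' = dot a c -> dot b' d' = dot b d -> vertex_defect a b c d a' b' c' d' = 0.
Proof.
move=> [n1 n2 n3 n4] [[aa bb cc dd] [ab bc da]] cd [s1 s2 s3 s4] ac bd.
have cb : dot c' b' = dot c b by rewrite dotC bc dotC.
have ad : dot a' d' = dot a d by rewrite dotC da dotC.
have dc : dot d' c' = dot d c by rewrite dotC cd dotC.
have ba : dot b' a' = dot b a by rewrite dotC ab dotC.
have pos (k : R) : k != 0 -> 0 < k * k by move=> k0; rewrite -expr2 exprn_even_gt0.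
rewrite /vertex_defect ac bd.
have -> : trip a' c' b' = trip a c b.
  apply: (@sqr_sign_inj _ (trip a c b)) => //; last exact: pos.
  by rewrite !trip_gramE aa ac cc ab cb bb.
have -> : trip a' c' d' = trip a c d.
  apply: (@sqr_sign_inj _ (trip a c d)) => //; last exact: pos.
  by rewrite !trip_gramE aa ac cc ad cd dd.
have -> : trip b' d' a' = trip b d a.
  apply: (@sqr_sign_inj _ (trip b d a)) => //; last exact: pos.
  by rewrite !trip_gramE bb bd dd ba da aa.
have -> : trip b' d' c' = trip b d c.
  apply: (@sqr_sign_inj _ (trip b d c)) => //; last exact: pos.
  by rewrite !trip_gramE bb bd dd bc dc cc.
by rewrite !subrr expr0n !addr0.
Qed.

Lemma frame_motion (M : 'M[R]_3) u v x u' v' x' : rotation M -> cross u v != 0 ->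
  u' = u *m M -> v' = v *m M -> dot x' u' = dot x u -> dot x' v' = dot x v ->
  trip u' v' x' = trip u v x -> x' = x *m M.
Proof.
move=> rM uv0 -> -> xu xv t.
have uvM : cross (u *m M) (v *m M) != 0.
  by rewrite -dotvv_eq0 -gramE /gram !dot_rotation // -/(gram u v) gramE dotvv_eq0.
by apply: (frame_inj uvM); rewrite ?dot_rotation // ?trip_rotation // -t.
Qed.

(** The four cases are the four corners of the central face of a window: at each of them another
    pair of neighbouring edges bounds that face. *)
Lemma vertex_motion a b c d a' b' c' d' (M : 'M[R]_3) : vertex_nondeg a b c d ->
  vertex_gram a b c d a' b' c' d' -> dot c' d' = dot c d ->
  vertex_defect a b c d a' b' c' d' = 0 -> rotation M ->
  [/\ c' = c *m M -> d' = d *m M -> a' = a *m M /\ b' = b *m M,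
      b' = b *m M -> c' = c *m M -> a' = a *m M /\ d' = d *m M,
      a' = a *m M -> d' = d *m M -> b' = b *m M /\ c' = c *m M &
      a' = a *m M -> b' = b *m M -> c' = c *m M /\ d' = d *m M].
Proof.
move=> [n1 n2 n3 n4] [_ [ab bc da]] cd /vertex_defect_eq0[[ac bd] [t1 t2 t3 t4]] rM.
have cb : dot c' b' = dot c b by rewrite dotC bc dotC.
have ad : dot a' d' = dot a d by rewrite dotC da dotC.
have dc : dot d' c' = dot d c by rewrite dotC cd dotC.
have ba : dot b' a' = dot b a by rewrite dotC ab dotC.
have ca : dot c' a' = dot c a by rewrite dotC ac dotC.
have db : dot d' b' = dot d b by rewrite dotC bd dotC.
have rot (x y z x' y' z' : 'rV[R]_3) :
    trip x' y' z' = trip x y z -> trip y' z' x' = trip y z x.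
  by move=> t; rewrite -[LHS]trip_rot t trip_rot.
have nz (x y z : 'rV[R]_3) : trip x y z != 0 -> cross y z != 0.
  by rewrite trip_rot; exact: trip_cross.
have nz2 (x y z : 'rV[R]_3) : trip x y z != 0 -> cross z x != 0.
  by rewrite trip_rot; exact: nz.
split=> hu hv; split.
- exact: frame_motion rM (nz _ _ _ n2) hu hv ac ad (rot _ _ _ _ _ _ t2).
- exact: frame_motion rM (nz _ _ _ n4) hv hu bd bc (rot _ _ _ _ _ _ t4).
- exact: frame_motion rM (nz _ _ _ n1) hv hu ac ab (rot _ _ _ _ _ _ t1).
- exact: frame_motion rM (nz2 _ _ _ n4) hv hu dc db (rot _ _ _ _ _ _ (rot _ _ _ _ _ _ t4)).
- exact: frame_motion rM (nz _ _ _ n3) hv hu bd ba (rot _ _ _ _ _ _ t3).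
- exact: frame_motion rM (nz2 _ _ _ n2) hv hu cd ca (rot _ _ _ _ _ _ (rot _ _ _ _ _ _ t2)).
- exact: frame_motion rM (nz2 _ _ _ n1) hv hu cb ca (rot _ _ _ _ _ _ (rot _ _ _ _ _ _ t1)).
- exact: frame_motion rM (nz2 _ _ _ n3) hu hv da db (rot _ _ _ _ _ _ (rot _ _ _ _ _ _ t3)).
Qed.

End Defect.

(** * Rigidity of a window without defect *)

Section Rigid.
Context {R : realType}.
Variables (m n : nat) (A B : nat -> nat -> R) (p : nat -> nat -> 'rV[R]_3).
Hypothesis reg : regular m n A B p.
Variables i j : nat.
Hypotheses (im : (i.+2 < m)%N) (jn : (j.+2 < n)%N).
Implicit Types q : nat -> nat -> 'rV[R]_3.

Definition window k l := ((i <= k < i.+3) && (j <= l < j.+3))%N.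

Definition defect q : R :=
  at_vertex (at_vertex vertex_defect p i j) q i j +
  at_vertex (at_vertex vertex_defect p i j.+1) q i j.+1 +
  at_vertex (at_vertex vertex_defect p i.+1 j) q i.+1 j +
  at_vertex (at_vertex vertex_defect p i.+1 j.+1) q i.+1 j.+1.

Lemma defect_eq0 q : defect q = 0 ->
  [/\ at_vertex (at_vertex vertex_defect p i j) q i j = 0,
  at_vertex (at_vertex vertex_defect p i j.+1) q i j.+1 = 0,
  at_vertex (at_vertex vertex_defect p i.+1 j) q i.+1 j = 0 &
  at_vertex (at_vertex vertex_defect p i.+1 j.+1) q i.+1 j.+1 = 0].
Proof.
have add4 (a b c d : R) : 0 <= a -> 0 <= b -> 0 <= c -> 0 <= d ->
    a + b + c + d = 0 -> [/\ a = 0, b = 0, c = 0 & d = 0].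
  by move=> *; split; lra.
by apply: add4; exact: vertex_defect_ge0.
Qed.

Lemma motion_dn (M : 'M[R]_3) (b : 'rV[R]_3) q k l :
  dn q k l = dn p k l *m M ->
  (q k.+1 l = motion M b (p k.+1 l) <-> q k l = motion M b (p k l)).
Proof.
rewrite /dn /motion mulmxBl => h; split=> e.
  apply/eqP; rewrite -subr_eq0 -[q k l](subKr (q k.+1 l)) h e.
  by apply/eqP/rowP => z; rewrite !mxE; ring.
by rewrite -[q k.+1 l](subrK (q k l)) h e; apply/rowP => z; rewrite !mxE; ring.
Qed.

Lemma motion_rt (M : 'M[R]_3) (b : 'rV[R]_3) q k l :
  rt q k l = rt p k l *m M ->
  (q k l.+1 = motion M b (p k l.+1) <-> q k l = motion M b (p k l)).
Proof.
rewrite /rt /motion mulmxBl => h; split=> e.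
  apply/eqP; rewrite -subr_eq0 -[q k l](subKr (q k l.+1)) h e.
  by apply/eqP/rowP => z; rewrite !mxE; ring.
by rewrite -[q k l.+1](subrK (q k l)) h e; apply/rowP => z; rewrite !mxE; ring.
Qed.

(** The fourth vertex is the affine combination of the other three with weights [1 - A - B], [A] and
    [B]; none of them is 0, so the relation can be solved for any vertex. *)
Lemma motion_face (M : 'M[R]_3) (b : 'rV[R]_3) q k l : (k < m)%N -> (l < n)%N ->
  face_rel A B q k l ->
  let ok := fun k l => q k l = motion M b (p k l) in
  [/\ ok k l -> ok k.+1 l -> ok k l.+1 -> ok k.+1 l.+1,
      ok k.+1 l -> ok k.+1 l.+1 -> ok k l.+1 -> ok k l,
      ok k l -> ok k l.+1 -> ok k.+1 l.+1 -> ok k.+1 l &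
      ok k l -> ok k.+1 l -> ok k.+1 l.+1 -> ok k l.+1].
Proof.
move=> km ln rq ok; have rp := reg_rel reg km ln.
have a0 := reg_A reg km ln; have b0 := reg_B reg km ln.
have c0 : 1 - A k l - B k l != 0.
  by have := reg_AB reg km ln; apply: contraNneq => h; apply/eqP; lra.
have lin (f : nat -> nat -> 'rV[R]_3) : face_rel A B f k l ->
   f k.+1 l.+1 = (1 - A k l - B k l) *: f k l + A k l *: f k.+1 l + B k l *: f k l.+1.
  by move=> /face_relE ->; rewrite /dn /rt; apply/rowP => z; rewrite !mxE; ring.
have rf : face_rel A B (fun k l => motion M b (p k l)) k l.
  move: rp; rewrite /face_rel /dn /rt /motion => /(congr1 (mulmx^~ M)).
  rewrite mulmxBl mulmxDl -!scalemxAl !mulmxBl => h.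
  have e (x y : 'rV[R]_3) : x + b - (y + b) = x - y.
    by apply/rowP => z; rewrite !mxE; ring.
  by rewrite !e.
pose d k l := q k l - motion M b (p k l).
have dE : d k.+1 l.+1 = (1 - A k l - B k l) *: d k l + A k l *: d k.+1 l + B k l *: d k l.+1.
  by rewrite /d (lin _ rq) (lin _ rf); apply/rowP => z; rewrite !mxE; ring.
have okP k' l' : ok k' l' <-> d k' l' = 0.
  by rewrite /ok /d; split=> [->|/eqP]; rewrite ?subrr // subr_eq0 => /eqP.
have sc (c : R) (x : 'rV[R]_3) : c != 0 -> 0 = c *: x -> x = 0.
  by move=> c0' /esym/eqP; rewrite scaler_eq0 (negPf c0') => /eqP.
split=> /okP h1 /okP h2 /okP h3; apply/okP; move: dE; rewrite h1 h2 h3 ?scaler0 ?addr0 ?add0r //.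
- exact: sc.
- exact: sc.
- exact: sc.
Qed.

(** The central face fixes the motion, and [vertex_motion] at its four corners extends it to the
    edges that leave this face. *)
Lemma defect_rigid q : (forall k l, window k l -> face_iso A B p q k l) ->
  defect q = 0 -> exists (M : 'M[R]_3) (b : 'rV[R]_3), rotation M /\
    forall k l, (i <= k <= i.+3)%N -> (j <= l <= j.+3)%N -> q k l = motion M b (p k l).
Proof.
move=> iso /defect_eq0[D00 D01 D10 D11].
have w k l : (k < 3)%N -> (l < 3)%N -> face_iso A B p q (i + k) (j + l).
  by move=> hk hl; apply: iso; rewrite /window !leq_addr -(addn3 i) -(addn3 j) !ltn_add2l hk hl.
have I00 := w 0%N 0%N isT isT.
have I01 := w 0%N 1%N isT isT.
have I02 := w 0%N 2%N isT isT.
have I10 := w 1%N 0%N isT isT.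
have I11 := w 1%N 1%N isT isT.
have I12 := w 1%N 2%N isT isT.
have I20 := w 2%N 0%N isT isT.
have I21 := w 2%N 1%N isT isT.
have I22 := w 2%N 2%N isT isT.
rewrite ?addn0 ?addn1 ?addn2 in I00 I01 I02 I10 I11 I12 I20 I21 I22.
have im' := ltnW im; have jn' := ltnW jn; have im'' := ltnW im'; have jn'' := ltnW jn'.
have [[_ [g1 g2 g3]]] := I11.
have [M [rM Mdn Mrt]] := frame_rotation (reg_cross reg im' jn') g1 g3 g2.
pose b := q i.+1 j.+1 - p i.+1 j.+1 *m M.
pose ok k l := q k l = motion M b (p k l).
have cdP k l : face_iso A B p q k.+1 l.+1 ->
  dot (dn q k.+1 l.+1) (rt q k.+1 l.+1) = dot (dn p k.+1 l.+1) (rt p k.+1 l.+1) by case=> _ [].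
have [V00 _ _ _] := vertex_motion (vertex_nondegP reg im' jn')
  (face_iso_vertex reg im' jn' I00 I01 I10) (cdP _ _ I11) D00 rM.
have [_ V01 _ _] := vertex_motion (vertex_nondegP reg im' jn)
  (face_iso_vertex reg im' jn I01 I02 I11) (cdP _ _ I12) D01 rM.
have [_ _ V10 _] := vertex_motion (vertex_nondegP reg im jn')
  (face_iso_vertex reg im jn' I10 I11 I20) (cdP _ _ I21) D10 rM.
have [_ _ _ V11] := vertex_motion (vertex_nondegP reg im jn)
  (face_iso_vertex reg im jn I11 I12 I21) (cdP _ _ I22) D11 rM.
have ok11 : ok i.+1 j.+1 by rewrite /ok /motion /b addrC subrK.
have ok21 : ok i.+2 j.+1 by apply/motion_dn.
have ok12 : ok i.+1 j.+2 by apply/motion_rt.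
have [+ _ _ _] := motion_face M b im' jn' I11.1; move=> /(_ ok11 ok21 ok12) ok22.
have dnM k l : ok k l -> ok k.+1 l -> dn q k l = dn p k l *m M.
  by rewrite /ok /dn /motion => -> ->; rewrite mulmxBl; apply/rowP => z; rewrite !mxE; ring.
have rtM k l : ok k l -> ok k l.+1 -> rt q k l = rt p k l *m M.
  by rewrite /ok /rt /motion => -> ->; rewrite mulmxBl; apply/rowP => z; rewrite !mxE; ring.
have [a00 b00] := V00 (dnM _ _ ok11 ok21) (rtM _ _ ok11 ok12).
have [a01 d01] := V01 (rtM _ _ ok11 ok12) (dnM _ _ ok12 ok22).
have [b10 c10] := V10 (dnM _ _ ok11 ok21) (rtM _ _ ok21 ok22).
have [c11 d11] := V11 (dnM _ _ ok12 ok22) (rtM _ _ ok21 ok22).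
have ok01 : ok i j.+1 by apply/(motion_dn _ a00).
have ok02 : ok i j.+2 by apply/(motion_dn _ a01).
have ok10 : ok i.+1 j by apply/(motion_rt _ b00).
have ok20 : ok i.+2 j by apply/(motion_rt _ b10).
have ok13 : ok i.+1 j.+3 by apply/(motion_rt _ d01).
have ok23 : ok i.+2 j.+3 by apply/(motion_rt _ d11).
have ok31 : ok i.+3 j.+1 by apply/(motion_dn _ c10).
have ok32 : ok i.+3 j.+2 by apply/(motion_dn _ c11).
(* The points left are the corners of the window, each the fourth vertex of a corner face. *)
have [_ F00 _ _] := motion_face M b im'' jn'' I00.1.
have [_ _ _ F02] := motion_face M b im'' jn I02.1.
have [_ _ F20 _] := motion_face M b im jn'' I20.1.
have [F22 _ _ _] := motion_face M b im jn I22.1.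
have ok00 := F00 ok10 ok11 ok01; have ok03 := F02 ok02 ok12 ok13.
have ok30 := F20 ok20 ok21 ok31; have ok33 := F22 ok22 ok32 ok23.
exists M, b; split=> // k l /andP[k1 k2] /andP[l1 l2].
rewrite -(subnKC k1) -(subnKC l1).
have : (k - i <= 3)%N by rewrite leq_subLR addn3.
have : (l - j <= 3)%N by rewrite leq_subLR addn3.
case: (l - j)%N => [|[|[|[|//]]]] _; case: (k - i)%N => [|[|[|[|//]]]] _;
  by rewrite ?addn0 ?addn1 ?addn2 ?addn3.
Qed.

End Rigid.

(** * The transfer identity of a flexible window *)

Section FlexibleWindow.
Context {R : realType}.
Variables (m n : nat) (A B : nat -> nat -> R) (p : nat -> nat -> 'rV[R]_3).
Hypothesis reg : regular m n A B p.
Variables i j : nat.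
Hypotheses (im : (i.+2 < m)%N) (jn : (j.+2 < n)%N).

(** The four lines bound the central face, and the identity goes round its corners. As all transfers
    fix 0, a vanishing [x] makes the other three parameters vanish, and with them the defect. *)
Lemma window_transfer q : (forall k l, window i j k l -> face_iso A B p q k l) ->
  vsign p q i j -> vsign p q i j.+1 -> vsign p q i.+1 j -> vsign p q i.+1 j.+1 ->
  let x := vpar A B p q i j.+1 in
  transfer A B p i.+1 j.+1 (transferV A B p i.+1 j (transfer A B p i j x))
    = transfer A B p i j.+1 x /\
  (x = 0 -> defect p i j q = 0).
Proof.
move=> iso S00 S01 S10 S11 x.
have w k l : (k < 3)%N -> (l < 3)%N -> face_iso A B p q (i + k) (j + l).
  by move=> hk hl; apply: iso; rewrite /window !leq_addr -(addn3 i) -(addn3 j) !ltn_add2l hk hl.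
have I00 := w 0%N 0%N isT isT.
have I01 := w 0%N 1%N isT isT.
have I02 := w 0%N 2%N isT isT.
have I10 := w 1%N 0%N isT isT.
have I11 := w 1%N 1%N isT isT.
have I12 := w 1%N 2%N isT isT.
have I20 := w 2%N 0%N isT isT.
have I21 := w 2%N 1%N isT isT.
have I22 := w 2%N 2%N isT isT.
rewrite ?addn0 ?addn1 ?addn2 in I00 I01 I02 I10 I11 I12 I20 I21 I22.
have im' := ltnW im; have jn' := ltnW jn; have im'' := ltnW im'; have jn'' := ltnW jn'.
have [h00 v00] := transferP reg im' jn' I00 I01 I10 I11 S00.
have [h01 v01] := transferP reg im' jn I01 I02 I11 I12 S01.
have [h10 v10] := transferP reg im jn' I10 I11 I20 I21 S10.
have [h11 v11] := transferP reg im jn I11 I12 I21 I22 S11.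
have x2 : vpar A B p q i j.+2 = x by apply: (vpar_step reg).
have z2 : vpar A B p q i.+1 j.+2 = vpar A B p q i.+1 j.+1 by apply: (vpar_step reg).
have y2 : hpar A B p q i.+2 j = hpar A B p q i.+1 j by apply: (hpar_step reg).
have w2 : hpar A B p q i.+2 j.+1 = hpar A B p q i.+1 j.+1 by apply: (hpar_step reg).
split.
  by rewrite -h00 -y2 -v10 -z2 -h11 w2 h01 x2.
move=> x0.
have hy : hpar A B p q i.+1 j = 0.
  by rewrite h00 -/x x0 (transfer0 reg).
have hw : hpar A B p q i.+1 j.+1 = 0.
  by rewrite h01 x2 x0 (transfer0 reg).
have hz : vpar A B p q i.+1 j.+1 = 0.
  by rewrite v10 y2 hy (transferV0 reg).
have cdP k l : face_iso A B p q k.+1 l.+1 ->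
  dot (dn q k.+1 l.+1) (rt q k.+1 l.+1) = dot (dn p k.+1 l.+1) (rt p k.+1 l.+1) by case=> _ [].
have small k l : (k.+1 < m)%N -> (l.+1 < n)%N -> face_iso A B p q k l ->
  face_iso A B p q k l.+1 -> face_iso A B p q k.+1 l -> face_iso A B p q k.+1 l.+1 ->
  vsign p q k l -> vpar A B p q k l.+1 = 0 -> hpar A B p q k.+1 l = 0 ->
  at_vertex (at_vertex vertex_defect p k l) q k l = 0.
  move=> km ln i1 i2 i3 i4 vs v0 h0; apply: vertex_defect_small (cdP _ _ i4) vs _ _.
  - exact: (vertex_nondegP reg).
  - exact: (face_iso_vertex reg).
  - apply/eqP; rewrite -subr_eq0 -/(vdot q k l.+1) -/(vdot p k l.+1).
    by rewrite (vdot_vparE reg) // v0 mulr0.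
  - apply/eqP; rewrite -subr_eq0 -/(hdot q k.+1 l) -/(hdot p k.+1 l).
    by rewrite (hdotE reg) // h0 mulr0.
rewrite /defect (small i j) // (small i j.+1) ?x2 // (small i.+1 j) ?y2 //.
by rewrite (small i.+1 j.+1) ?z2 ?w2 // !addr0.
Qed.

Variables (e : R) (Q : R -> nat -> nat -> 'rV[R]_3).
Hypotheses (e0 : 0 < e).
Hypothesis Qc : forall s k l, - e < s < e -> cvrow (fun s => Q s k l) s.
Hypothesis Q0 : forall k l, (i <= k <= i.+3)%N -> (j <= l <= j.+3)%N -> Q 0 k l = p k l.
Hypothesis Qiso : forall s k l, - e < s < e -> window i j k l -> face_iso A B p (Q s) k l.
Hypothesis Qflex : exists2 s, - e < s < e & ~ exists (M : 'M[R]_3) (b : 'rV[R]_3), rotation M /\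
    forall k l, (i <= k <= i.+3)%N -> (j <= l <= j.+3)%N -> Q s k l = motion M b (p k l).

Lemma cv_dn s k l : - e < s < e -> cvrow (fun s => dn (Q s) k l) s.
Proof. by move=> se; apply: cvrowB; exact: Qc. Qed.

Lemma cv_rt s k l : - e < s < e -> cvrow (fun s => rt (Q s) k l) s.
Proof. by move=> se; apply: cvrowB; exact: Qc. Qed.

Lemma cv_vertex_defect s k l : - e < s < e ->
  {for s, continuous (fun s => at_vertex (at_vertex vertex_defect p k l) (Q s) k l)}.
Proof.
move=> se; have sq (f : R -> R) c : {for s, continuous f} ->
    {for s, continuous (fun t => (f t - c) ^+ 2)}.
  move=> cf; apply: (@continuous_comp R R R (fun t => f t - c) (fun y => y ^+ 2)).
    by apply: cvgB => //; exact: cvg_cst.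
  exact: exprn_continuous.
have [a b] := (@cv_dn s k l.+1 se, @cv_rt s k.+1 l se).
have [c d] := (@cv_dn s k.+1 l.+1 se, @cv_rt s k.+1 l.+1 se).
rewrite /at_vertex /vertex_defect.
apply: cvgD; [apply: cvgD; [apply: cvgD; [apply: cvgD; [apply: cvgD|]|]|]|]; apply: sq.
- exact: cvrow_dot.
- exact: cvrow_dot.
- exact: cvrow_trip.
- exact: cvrow_trip.
- exact: cvrow_trip.
- exact: cvrow_trip.
Qed.

Lemma cv_defect s : - e < s < e -> {for s, continuous (fun s => defect p i j (Q s))}.
Proof.
by move=> se; apply: cvgD; [apply: cvgD; [apply: cvgD|]|]; exact: cv_vertex_defect.
Qed.

Lemma at_vertex_congr T (F : 'rV[R]_3 -> 'rV[R]_3 -> 'rV[R]_3 -> 'rV[R]_3 -> T) q q' k l :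
  (forall k' l', (k <= k' <= k.+2)%N -> (l <= l' <= l.+2)%N -> q k' l' = q' k' l') ->
  at_vertex F q k l = at_vertex F q' k l.
Proof.
by move=> qq'; rewrite /at_vertex /dn /rt !qq' // ?leqnn ?leqnSn ?leqW // !leqnn.
Qed.

Lemma defect0 : defect p i j (Q 0) = 0.
Proof.
have s k l : (i <= k <= i.+1)%N -> (j <= l <= j.+1)%N ->
    at_vertex (at_vertex vertex_defect p k l) (Q 0) k l = 0.
  move=> /andP[k1 k2] /andP[l1 l2]; rewrite (@at_vertex_congr _ _ _ p).
    exact: vertex_defect_xx.
  move=> k' l' /andP[a1 a2] /andP[b1 b2]; apply: Q0; apply/andP; split.
  - exact: leq_trans a1.
  - by apply: leq_trans a2 _; rewrite !ltnS.
  - exact: leq_trans b1.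
  - by apply: leq_trans b2 _; rewrite !ltnS.
by rewrite /defect !s ?addr0 // ?leqnn ?leqnSn.
Qed.

(** At a zero of the defect the triple products are those of [p], hence nonzero; their signs persist
    nearby. *)
Lemma near_vsign s k l : (k.+1 < m)%N -> (l.+1 < n)%N -> - e < s < e ->
  at_vertex (at_vertex vertex_defect p k l) (Q s) k l = 0 ->
  \forall t \near s, vsign p (Q t) k l.
Proof.
move=> km ln se /vertex_defect_eq0[_ [t1 t2 t3 t4]].
have [n1 n2 n3 n4] := vertex_nondegP reg km ln.
have [a b] := (@cv_dn s k l.+1 se, @cv_rt s k.+1 l se).
have [c d] := (@cv_dn s k.+1 l.+1 se, @cv_rt s k.+1 l.+1 se).
have pos (f : R -> R) (y : R) : {for s, continuous f} -> f s = y -> y != 0 ->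
    \forall t \near s, 0 < y * f t.
  move=> cf fy y0; have cg : {for s, continuous (fun t => y * f t)}.
    by apply: cvgM => //; exact: cvg_cst.
  by apply: (cg _ (lt_nbhsr _)); rewrite fy -expr2 exprn_even_gt0.
have p1 := pos _ _ (cvrow_trip a c b) t1 n1.
have p2 := pos _ _ (cvrow_trip a c d) t2 n2.
have p3 := pos _ _ (cvrow_trip b d a) t3 n3.
have p4 := pos _ _ (cvrow_trip b d c) t4 n4.
by near=> t; split; near: t.
Unshelve. all: by end_near. Qed.

(** At the last zero [s0] of the defect, the parameter [X] is 0. Arbitrarily close to [s0] the
    defect is nonzero, which forces [X s != 0], while continuity makes [X s] small: these values are
    the zeros of [G] accumulating at 0. *)
Lemma flexible_transfer : \forall x \near (0 : R),
  transfer A B p i.+1 j.+1 (transferV A B p i.+1 j (transfer A B p i j x))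
    = transfer A B p i j.+1 x.
Proof.
have im' := ltnW im; have jn' := ltnW jn.
pose G x := transfer A B p i.+1 j.+1 (transferV A B p i.+1 j (transfer A B p i j x))
    - transfer A B p i j.+1 x.
have rG : radical G.
  have r00 := transfer_radical reg im' jn'; have r01 := transfer_radical reg im' jn.
  have r10 := transferV_radical reg im jn'; have r11 := transfer_radical reg im jn.
  apply: radicalB => //; apply: (radical_comp r11).
    by apply: (radical_comp r10) => //; rewrite (transfer0 reg).
  by rewrite (transfer0 reg) // (transferV0 reg).
suff : \forall x \near (0 : R), G x = 0.
  by move=> hG; near=> x; apply/eqP; rewrite -subr_eq0 -/(G x); apply/eqP; near: x.
apply: (radical_identity rG) => d d0.
have [s1 s1e Qs1] := Qflex.
have Zs1 : defect p i j (Q s1) != 0.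
  apply/eqP => Z1; apply: Qs1; apply: (defect_rigid reg im jn) Z1 => k l.
  exact: Qiso.
have [s0 [s0e Z0 acc]] := last_zero e0 cv_defect defect0 s1e Zs1.
have [d00 d01 d10 d11] := defect_eq0 Z0.
have S00 := near_vsign im' jn' s0e d00.
have S01 := near_vsign im' jn s0e d01.
have S10 := near_vsign im jn' s0e d10.
have S11 := near_vsign im jn s0e d11.
pose X s := vpar A B p (Q s) i j.+1.
have cX : {for s0, continuous X}.
  apply: cvgM; last exact: cvg_cst.
  apply: cvgB; last exact: cvg_cst.
  by apply: cvrow_dot; exact: cv_dn.
have X0 : X s0 = 0.
  have [[ac _] _] := vertex_defect_eq0 d00.
  by rewrite /X /vpar /hpar [hdot _ _ _]ac subrr mul0r.
have Xd : \forall s \near s0, - d < X s < d.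
  have h : \forall x \near X s0, - d < x < d by rewrite X0; apply: near_itv; rewrite oppr_lt0 d0.
  exact: (cX _ h).
have [s [se Zs [[h00 h01] [h10 h11] hX]]] : exists s, [/\ - e < s < e, defect p i j (Q s) != 0 &
   [/\ vsign p (Q s) i j /\ vsign p (Q s) i j.+1,
       vsign p (Q s) i.+1 j /\ vsign p (Q s) i.+1 j.+1 & - d < X s < d]].
  by apply: acc; near=> s; split; [split|split|]; near: s.
have [eqT X0D] := window_transfer (fun k l => Qiso se) h00 h01 h10 h11.
exists (X s); split=> //.
- by apply: contraNneq Zs => /X0D ->.
- by rewrite /G eqT subrr.
Unshelve. all: by end_near. Qed.

End FlexibleWindow.

(** * Construction of the deformation *)

Section HingeFunctions.
Context {R : realType}.
Variables (m n : nat) (A B : nat -> nat -> R) (p : nat -> nat -> 'rV[R]_3).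
Hypothesis reg : regular m n A B p.
Hypothesis window_ok : forall i j, (i.+2 < m)%N -> (j.+2 < n)%N ->
  \forall x \near (0 : R),
  transfer A B p i.+1 j.+1 (transferV A B p i.+1 j (transfer A B p i j x))
    = transfer A B p i j.+1 x.

Lemma near_radical_comp g (P : R -> Prop) : radical g -> g 0 = 0 ->
  (\forall t \near (0 : R), P t) -> \forall t \near (0 : R), P (g t).
Proof. by move=> /radical_continuous; exact: near0_comp. Qed.

Lemma hinge_functions : exists x y : nat -> R -> R,
  [/\ (forall i, radical (x i) /\ x i 0 = 0), (forall j, radical (y j) /\ y j 0 = 0),
      (forall i j, (i.+1 < m)%N -> (j.+1 < n)%N ->
         \forall t \near (0 : R), y j t = transfer A B p i j (x i t)) &
      if (1 < m)%N then x 0%N = id else y 0%N = id].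
Proof.
have [c0 i0] : (radical (fun=> 0 : R) /\ (0 : R) = 0) /\ (radical (@id R) /\ (0 : R) = 0).
  by do 2!split=> //; [exact: radical_cst|exact: radical_id].
(* With interior lines in at most one direction there is no vertex relation, and all lines of that
   direction may take the parameter [t]. *)
have [m1|m1] := ltnP 1 m; last first.
  exists (fun _ _ => 0), (fun _ => id); split; [move=> i|move=> j|move=> i j im|by []].
    exact: c0.
    exact: i0.
  by move: (leq_trans im m1).
have [n1|n1] := ltnP 1 n; last first.
  exists (fun _ => id), (fun _ _ => 0); split; [move=> i|move=> j|move=> i j im jn|by []].
    exact: i0.
    exact: c0.
  by move: (leq_trans jn n1).
pose y j := if (j.+1 < n)%N then transfer A B p 0 j else fun=> 0.
pose x i := if i is i'.+1 then
  if (i.+1 < m)%N then fun t => transferV A B p i 0 (transfer A B p 0 0 t) else fun=> 0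
  else id.
have yP j : radical (y j) /\ y j 0 = 0.
  rewrite /y; case: ifP => // jn; split; first exact: transfer_radical reg _ _ m1 jn.
  exact: transfer0 reg _ _ m1 jn.
have xP i : radical (x i) /\ x i 0 = 0.
  case: i => [//|i]; rewrite /x; case: ifP => // im.
  split.
    apply: radical_comp; first exact: (transferV_radical reg im n1).
      exact: (transfer_radical reg m1 n1).
    exact: (transfer0 reg m1 n1).
  by rewrite (transfer0 reg m1 n1) (transferV0 reg im n1).
(* Row 0 holds by definition and column 0 by inversion of a transfer. The window at [i], [j],
   evaluated at [x i t], gives the relation at its lower right vertex from those at the other
   three. *)
exists x, y; split=> //; elim=> [|i IH] j im jn.
  by near=> t; rewrite /y jn.
elim: j jn => [|j IHj] jn.
  have h := near_radical_comp (yP 0%N).1 (yP 0%N).2 (transferVK reg im jn).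
  have yE t : transfer A B p 0 0 t = y 0%N t by rewrite /y jn.
  near=> t; rewrite /x im yE; apply/esym; near: t; exact: h.
have [im' jn'] := (ltnW im, ltnW jn).
have h1 := near_radical_comp (xP i).1 (xP i).2 (window_ok im jn).
have h2 := near_radical_comp (xP i.+1).1 (xP i.+1).2 (transferK reg im jn').
have h3 := IH j im' jn'; have h4 := IH j.+1 im' jn; have h5 := IHj jn'.
near=> t.
rewrite (near h4 t) // -(near h1 t) // -(near h3 t) // (near h5 t) //.
by rewrite (near h2 t).
Unshelve. all: by end_near. Qed.

End HingeFunctions.

(** * A strip of faces with prescribed hinge parameters *)

Section Strip.
Context {R : realType}.
Variables (m n : nat) (A B : nat -> nat -> R) (p : nat -> nat -> 'rV[R]_3).
Hypothesis reg : regular m n A B p.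
Hypothesis m0 : (0 < m)%N.
Variable y : nat -> R -> R.
Hypotheses (ry : forall j, radical (y j)) (y0 : forall j, y j 0 = 0).

(** [D k] and [r k] are the left and upper edges of the [k]-th face of the first row. [strip_first]
    removes the freedom of a global motion by holding the first face still. *)
Record strip_at (D r : nat -> R -> 'rV[R]_3) k : Prop := StripAt {
  strip_D : radicalv (D k);
  strip_r : radicalv (r k);
  strip_D0 : D k 0 = dn p 0 k;
  strip_r0 : r k 0 = rt p 0 k;
  strip_gram : \forall t \near (0 : R), [/\
    dot (D k t) (D k t) = dot (dn p 0 k) (dn p 0 k),
    dot (r k t) (r k t) = dot (rt p 0 k) (rt p 0 k) &
    dot (D k t) (r k t) = dot (dn p 0 k) (rt p 0 k)];
  strip_first : k = 0%N -> forall t, D 0%N t = dn p 0 0 /\ r 0%N t = rt p 0 0;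
  strip_next : forall k', k = k'.+1 ->
    (forall t, D k t = A 0 k' *: D k' t + (B 0 k' - 1) *: r k' t) /\
    \forall t \near (0 : R), dot (r k' t) (r k t) = hdot p 0 k' + y k' t }.

(** The previous face forces the left edge of the next one. The upper edge is then solved for from
    its hinge product, its angle with the left edge and its length; [reg_h] provides the nonzero
    triple product. *)
Lemma strip_exists N : (N < n)%N -> exists D r, forall k, (k <= N)%N -> strip_at D r k.
Proof.
elim: N => [|N IH] Nn.
  exists (fun _ _ => dn p 0 0), (fun _ _ => rt p 0 0) => k; rewrite leqn0 => /eqP ->.
  by split=> //; [exact: radicalv_cst|exact: radicalv_cst|near=> t].
have [D [r Dr]] := IH (ltnW Nn).
have [rD rr D0 r0 gr _ _] := Dr N (leqnn N).
have rel := reg_rel reg m0 (ltnW Nn).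
pose D1 t := A 0 N *: D N t + (B 0 N - 1) *: r N t.
have rD1 : radicalv D1.
  by apply: radicalvD; apply: radicalvZ => //; exact: radical_cst.
have D10 : D1 0 = dn p 0 N.+1 by rewrite /D1 D0 r0 (dn_next rel).
have tr0 : trip (r N 0) (D1 0) (rt p 0 N.+1) != 0 by rewrite D10 r0 (reg_h reg).
have [r1 [rr1 r10 hr1]] : exists r1, [/\ radicalv r1, r1 0 = rt p 0 N.+1 &
    \forall t \near (0 : R), [/\ dot (r1 t) (r N t) = hdot p 0 N + y N t,
    dot (r1 t) (D1 t) = dot (rt p 0 N.+1) (dn p 0 N.+1) &
    dot (r1 t) (r1 t) = dot (rt p 0 N.+1) (rt p 0 N.+1)]].
  apply: radical_solve => //.
  - by apply: radicalD => //; exact: radical_cst.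
  - exact: radical_cst.
  - exact: radical_cst.
  - by rewrite y0 addr0 r0 dotC.
  - by rewrite D10.
exists (fun k => if k == N.+1 then D1 else D k), (fun k => if k == N.+1 then r1 else r k) => k.
rewrite leq_eqVlt => /orP[/eqP ->|]; last first.
  rewrite ltnS => kN; have [s1 s2 s3 s4 s5 s6 s7] := Dr k kN.
  have kN1 k' : (k' <= N)%N -> (k' == N.+1) = false by move=> h; rewrite ltn_eqF.
  split; rewrite ?kN1 //.
  by move=> k' kk'; rewrite [k' == _]kN1; [exact: s7|apply: ltnW; rewrite -kk'].
split; rewrite ?eqxx //.
- near=> t.
  have [g1 g2 g3] : [/\
    dot (D N t) (D N t) = dot (dn p 0 N) (dn p 0 N),
    dot (r N t) (r N t) = dot (rt p 0 N) (rt p 0 N) &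
    dot (D N t) (r N t) = dot (dn p 0 N) (rt p 0 N)] by near: t.
  have [h1 h2 h3] : [/\ dot (r1 t) (r N t) = hdot p 0 N + y N t,
     dot (r1 t) (D1 t) = dot (rt p 0 N.+1) (dn p 0 N.+1) &
     dot (r1 t) (r1 t) = dot (rt p 0 N.+1) (rt p 0 N.+1)] by near: t.
  split=> //; last by rewrite dotC h2 dotC.
  rewrite (dn_next rel) /D1; move: g1 g2 g3.
  move: (D N t) (r N t) (dn p 0 N) (rt p 0 N) => a b a' b' g1 g2 g3.
  by rewrite !dot_lin g1 g2 g3 [dot b a]dotC g3 [dot b' a']dotC.
- move=> k' [<-]; rewrite ltn_eqF //; split=> //; near=> t.
  have [h1 _ _] : [/\ dot (r1 t) (r N t) = hdot p 0 N + y N t,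
     dot (r1 t) (D1 t) = dot (rt p 0 N.+1) (dn p 0 N.+1) &
     dot (r1 t) (r1 t) = dot (rt p 0 N.+1) (rt p 0 N.+1)] by near: t.
  by rewrite dotC.
Unshelve. all: by end_near. Qed.

(** Quantifying over every [q] with these upper edges lets one net realize both a horizontal strip
    and, transposed, a vertical one. The constant first edge of each strip is the condition that the
    other puts on [dn (q t) 0 0]. *)
Lemma strip_net : (0 < n)%N -> exists r : nat -> R -> 'rV[R]_3,
  [/\ (forall k, (k < n)%N -> radicalv (r k)),
      (forall k, (k < n)%N -> r k 0 = rt p 0 k),
      (forall t, r 0%N t = rt p 0 0) &
      forall q : R -> nat -> nat -> 'rV[R]_3,
      (forall t k, (k < n)%N -> face_rel A B (q t) 0 k) ->
      (forall t k, (k < n)%N -> rt (q t) 0 k = r k t) ->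
      (forall t, dn (q t) 0 0 = dn p 0 0) ->
      (forall k, (k < n)%N -> \forall t \near (0 : R), face_iso A B p (q t) 0 k) /\
      (forall k, (k.+1 < n)%N -> \forall t \near (0 : R), hpar A B p (q t) 0 k = y k t)].
Proof.
move=> n0; have [|D [r Dr]] := @strip_exists n.-1; first by rewrite prednK.
have {}Dr k : (k < n)%N -> strip_at D r k.
  by move=> kn; apply: Dr; rewrite -ltnS prednK.
exists r; split.
- by move=> k /Dr[].
- by move=> k /Dr[].
- by move=> t; case: (strip_first (Dr _ n0) erefl t).
move=> q relq rq dq.
have dnq t k : (k < n)%N -> dn (q t) 0 k = D k t.
  elim: k => [|k IH] kn; first by rewrite dq; case: (strip_first (Dr _ n0) erefl t).
  have [-> _] := strip_next (Dr _ kn) erefl.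
  by rewrite (dn_next (relq t k (ltnW kn))) IH ?rq // ltnW.
split=> k kn.
  have g := strip_gram (Dr _ kn); near=> t; split; first exact: relq.
  by rewrite /face_gram dnq // rq //; near: t.
have [_ h] := strip_next (Dr _ kn) erefl; near=> t.
rewrite /hpar /hdot !rq ?(near h t) //; last exact: ltnW.
by rewrite -/(hdot p 0 k) addrC addKr /scale big_ord0 divr1.
Unshelve. all: by end_near. Qed.

End Strip.

(** * Completing a net from its first row and column of points *)

Section Fill.
Context {R : realType}.
Variables (A B : nat -> nat -> R).
Implicit Types (top left : nat -> 'rV[R]_3).

(** Each new point is the fourth vertex given by [face_relE]. Every face thus has the right affine
    shape for any boundary, and only its lengths and angle remain to be checked. *)
Fixpoint fill_row (prev : nat -> 'rV[R]_3) (l : 'rV[R]_3) (i j : nat) : 'rV[R]_3 :=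
  if j is j'.+1 then
    prev j' + (A i j' *: (fill_row prev l i j' - prev j') + B i j' *: (prev j'.+1 - prev j'))
  else l.

Fixpoint fill top left (i : nat) : nat -> 'rV[R]_3 :=
  if i is i'.+1 then fill_row (fill top left i') (left i) i' else top.

Lemma fill_rel top left i j : face_rel A B (fill top left) i j.
Proof. by rewrite /face_rel /= addrC addKr. Qed.

Lemma fill_left top left i : top 0%N = left 0%N -> fill top left i 0 = left i.
Proof. by case: i. Qed.

Lemma fill_eq m n (p : nat -> nat -> 'rV[R]_3) top left :
  (forall i j, (i < m)%N -> (j < n)%N -> face_rel A B p i j) ->
  (forall j, (j <= n)%N -> top j = p 0 j) -> (forall i, (i <= m)%N -> left i = p i 0%N) ->
  forall i j, (i <= m)%N -> (j <= n)%N -> fill top left i j = p i j.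
Proof.
move=> rel ht hl; elim=> [|i IH] j im jn; first exact: ht.
elim: j jn => [|j IHj] jn; first exact: hl.
rewrite (face_relE (fill_rel _ _ _ _)) (face_relE (rel _ _ im jn)) /dn /rt.
by rewrite -(IHj (ltnW jn)) -!IH // ltnW.
Qed.

Lemma fill_radical (top left : R -> nat -> 'rV[R]_3) i j :
  (forall k, (k <= j)%N -> radicalv (fun t => top t k)) ->
  (forall k, (k <= i)%N -> radicalv (fun t => left t k)) ->
  radicalv (fun t => fill (top t) (left t) i j).
Proof.
elim: i j => [|i IH] j rt rl; first exact: rt.
elim: j rt => [|j IHj] rt; first exact: rl.
have rc := @radical_cst R.
have h : radicalv (fun t => fill (top t) (left t) i j).
  by apply: IH => k kj; [apply: rt|apply: rl]; exact: leqW.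
apply: radicalvD => //; apply: radicalvD; apply: radicalvZ => //; apply: radicalvB => //.
- by apply: IHj => k kj; apply: rt; exact: leqW.
- by apply: IH => // k kj; apply: rl; exact: leqW.
Qed.

End Fill.

(** * The family of nets with given hinge functions *)

Section Global.
Context {R : realType}.
Variables (m n : nat) (A B : nat -> nat -> R) (p : nat -> nat -> 'rV[R]_3).
Hypothesis reg : regular m n A B p.
Hypotheses (m0 : (0 < m)%N) (n0 : (0 < n)%N).

Lemma path_sum (r : nat -> 'rV[R]_3) (f : nat -> 'rV[R]_3) N :
  (forall k, (k < N)%N -> r k = f k.+1 - f k) -> f 0%N + \sum_(k < N) r k = f N.
Proof.
elim: N => [|N IH] h; first by rewrite big_ord0 addr0.
rewrite big_ord_recr /= addrA IH ?h ?(addrC (f N)) ?subrK // => k kN.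
by apply: h; exact: leqW.
Qed.

Lemma radicalv_sum (r : nat -> R -> 'rV[R]_3) (c : 'rV[R]_3) N :
  (forall k, (k < N)%N -> radicalv (r k)) -> radicalv (fun t => c + \sum_(k < N) r k t).
Proof.
elim: N => [|N IH] h i.
  by apply: radical_ext (radical_cst (c 0 i)) _; near=> t; rewrite big_ord0 addr0.
have h1 : radicalv (fun t => (c + \sum_(k < N) r k t) + r N t).
  by apply: radicalvD; [apply: IH => k kN; apply: h; exact: leqW|exact: h].
apply: radical_ext (h1 i) _; near=> t.
by rewrite big_ord_recr /= addrA.
Unshelve. all: by end_near. Qed.

Lemma near_sign_radical (f : R -> R) (y : R) : radical f -> f 0 = y -> y != 0 ->
  \forall t \near (0 : R), 0 < y * f t.
Proof.
move=> rf f0 y0; apply: (@continuous_near0_gt0 _ (fun t => y * f t)).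
  by apply: radical_continuous; apply: radicalM => //; exact: radical_cst.
by rewrite f0 -expr2 exprn_even_gt0.
Qed.

Variables x y : nat -> R -> R.
Hypotheses (rx : forall i, radical (x i) /\ x i 0 = 0)
  (ry : forall j, radical (y j) /\ y j 0 = 0).
Hypothesis xy : forall i j, (i.+1 < m)%N -> (j.+1 < n)%N ->
  \forall t \near (0 : R), y j t = transfer A B p i j (x i t).

(** The strips settle the first row and column of faces. Any other face completes a block of two by
    two faces, where [transfer_closing] applies because the two line parameters there satisfy
    [xy]. *)
Lemma net_of_hinge_functions : exists q : R -> nat -> nat -> 'rV[R]_3,
  [/\ (forall i j, (i <= m)%N -> (j <= n)%N -> radicalv (fun t => q t i j)),
      (forall i j, (i <= m)%N -> (j <= n)%N -> q 0 i j = p i j),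
      (forall i j, (i < m)%N -> (j < n)%N -> \forall t \near (0 : R), face_iso A B p (q t) i j),
      (forall j, (j.+1 < n)%N -> \forall t \near (0 : R), hpar A B p (q t) 0 j = y j t) &
      (forall i, (i.+1 < m)%N -> \forall t \near (0 : R), vpar A B p (q t) i 0 = x i t)].
Proof.
have [r [rr r0 rfst hstrip]] :=
  strip_net reg m0 (fun j => (ry j).1) (fun j => (ry j).2) n0.
have [d [rd d0 dfst vstrip]] :=
  strip_net (regular_tr reg) n0 (fun j => (rx j).1) (fun j => (rx j).2) m0.
pose top t j := p 0%N 0%N + \sum_(k < j) r k t.
pose left t i := p 0%N 0%N + \sum_(k < i) d k t.
pose q t := fill A B (top t) (left t).
have tl t : top t 0%N = left t 0%N by rewrite /top /left !big_ord0.
have qrel t i j : face_rel A B (q t) i j by exact: fill_rel.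
have qrt t k : rt (q t) 0 k = r k t.
  rewrite /rt -[q t 0%N k.+1]/(top t k.+1) -[q t 0%N k]/(top t k) /top.
  by rewrite big_ord_recr /= opprD addrACA subrr add0r addrC addKr.
have qdn t k : dn (q t) k 0 = d k t.
  rewrite /dn /q !fill_left // /left big_ord_recr /=.
  by rewrite opprD addrACA subrr add0r addrC addKr.
have rq i j : (i <= m)%N -> (j <= n)%N -> radicalv (fun t => q t i j).
  move=> im jn; apply: fill_radical => k kl; apply: radicalv_sum => k' k'k.
    by apply: rr; exact: leq_trans (leq_trans k'k kl) jn.
  by apply: rd; exact: leq_trans (leq_trans k'k kl) im.
have q0 i j : (i <= m)%N -> (j <= n)%N -> q 0 i j = p i j.
  apply: fill_eq => [i' j' im jn|j' jn|i' im].
  - exact: (reg_rel reg).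
  - apply: (@path_sum (fun k => r k 0) (fun k => p 0%N k)) => k kj.
    by rewrite r0 //; exact: leq_trans jn.
  - apply: (@path_sum (fun k => d k 0) (fun k => p k 0%N)) => k ki.
    by rewrite d0 //; exact: leq_trans im.
have [h0 hy] := hstrip q (fun t k _ => qrel t 0%N k) (fun t k _ => qrt t k)
  (fun t => etrans (qdn t 0%N) (dfst t)).
have [v0 vx] := vstrip (fun t => tr (q t)) (fun t k _ => face_rel_tr (qrel t k 0%N))
  (fun t k _ => qdn t k) (fun t => etrans (qrt t 0%N) (rfst t)).
exists q; split=> //.
have rdn i j : (i < m)%N -> (j <= n)%N -> radicalv (fun t => dn (q t) i j).
  by move=> im jn; apply: radicalvB; apply: rq => //; exact: ltnW.
have rrt i j : (i <= m)%N -> (j < n)%N -> radicalv (fun t => rt (q t) i j).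
  by move=> im jn; apply: radicalvB; apply: rq => //; exact: ltnW.
have sgn i j : (i.+1 < m)%N -> (j.+1 < n)%N -> \forall t \near (0 : R), vsign p (q t) i j.
  move=> im jn; have [im' jn'] := (ltnW im, ltnW jn).
  have [n1 n2 n3 n4] := vertex_nondegP reg im jn.
  have [ra rb] := (rdn i j.+1 im' jn', rrt i.+1 j im' jn').
  have [rc re] := (rdn i.+1 j.+1 im jn', rrt i.+1 j.+1 im' jn).
  have a0 : dn (q 0) i j.+1 = dn p i j.+1 by rewrite /dn !q0 // ltnW.
  have b0 : rt (q 0) i.+1 j = rt p i.+1 j by rewrite /rt !q0 // ltnW.
  have c0 : dn (q 0) i.+1 j.+1 = dn p i.+1 j.+1 by rewrite /dn !q0 // ltnW.
  have e0 : rt (q 0) i.+1 j.+1 = rt p i.+1 j.+1 by rewrite /rt !q0 // ltnW.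
  have p1 := near_sign_radical (radicalv_trip ra rc rb) _ n1.
  have p2 := near_sign_radical (radicalv_trip ra rc re) _ n2.
  have p3 := near_sign_radical (radicalv_trip rb re ra) _ n3.
  have p4 := near_sign_radical (radicalv_trip rb re rc) _ n4.
  rewrite /= a0 b0 c0 e0 in p1 p2 p3 p4.
  by near=> t; split; near: t; [exact: p1|exact: p2|exact: p3|exact: p4].
suff rows i : (i < m)%N ->
    (forall j, (j < n)%N -> \forall t \near (0 : R), face_iso A B p (q t) i j) /\
    (forall j, (j.+1 < n)%N -> \forall t \near (0 : R), hpar A B p (q t) i j = y j t).
  by move=> i j im; exact: (rows i im).1.
elim: i => [|i IH] im; first by split; [exact: h0|exact: hy].
have [im' [hi yi]] := (ltnW im, IH (ltnW im)).
(* By [hpar_step] the column parameters at row [i.+1] depend on the faces of row [i] alone, so they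
   are known before the new faces. *)
have hy1 j : (j.+1 < n)%N -> \forall t \near (0 : R), hpar A B p (q t) i.+1 j = y j t.
  move=> jn; have f1 := hi _ (ltnW jn); have f2 := hi _ jn; have f3 := yi _ jn.
  near=> t; rewrite -(near f3 t) //; apply: (hpar_step reg) => //; near: t.
    exact: f1.
  exact: f2.
split=> // j jn.
suff : (\forall t \near (0 : R), face_iso A B p (q t) i.+1 j) /\
       (\forall t \near (0 : R), vpar A B p (q t) i j = x i t) by case.
elim: j jn => [|j IHj] jn.
  split; last exact: vx.
  by have h := v0 _ im; near=> t; apply: (@face_iso_tr _ (tr B) (tr A) (tr p) (tr (q t))); near: t.
have jn' := ltnW jn; have [f10 v10] := IHj jn'.
have f00 := hi j jn'; have f01 := hi j.+1 jn.
have v1 : \forall t \near (0 : R), vpar A B p (q t) i j.+1 = x i t.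
  near=> t; rewrite -(near v10 t) //; apply: (vpar_step reg) => //; near: t.
    exact: f00.
  exact: f10.
split=> //.
have cl := near_radical_comp (rx i).1 (rx i).2 (transfer_closing reg im jn).
have hyj := hy1 j jn; have xyj := xy im jn; have s := sgn i j im jn.
near=> t; apply: (near cl t _ (q t)) => //; near: t => //.
near=> t; rewrite -(near xyj t) //; near: t; exact: hyj.
Unshelve. all: by end_near. Qed.

End Global.

(** * Convex planar quadrilaterals *)

Section Quad.
Context {R : realType}.
Implicit Types (q : 'I_4 -> 'rV[R]_3) (u v w x y b : 'rV[R]_3) (M : 'M[R]_3).

Lemma segmentl x y : segment x y x.
Proof. by exists 0; [rewrite /= lexx ler01|rewrite subr0 scale1r scale0r addr0]. Qed.

Lemma segmentr x y : segment x y y.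
Proof. by exists 1; [rewrite /= lexx ler01|rewrite subrr scale1r scale0r add0r]. Qed.

Lemma segmentC x y : segment x y = segment y x.
Proof.
suff sub u v : segment u v `<=` segment v u by apply/seteqP; split; exact: sub.
move=> _ [s /= /andP[s0 s1] <-]; exists (1 - s); first by apply/andP; split; lra.
by rewrite subKr addrC.
Qed.

Lemma segment_scale x u c : 0 <= c <= 1 -> segment x (x + u) (x + c *: u).
Proof.
move=> c01; exists c => //; apply/rowP => i; rewrite !mxE; ring.
Qed.

Lemma simple_quad_neq q k : simple_quad q -> q k != q (k + 1).
Proof.
move=> [_ opp]; apply/eqP => qk.
have := opp (k + 1); rewrite -!addrA.
have -> : 1 + 3%:R = 0 :> 'I_4 by exact: val_inj.
rewrite addr0 => h; suff : set0 (q k) by [].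
by rewrite -h; split; [rewrite qk; exact: segmentl|exact: segmentr].
Qed.

Lemma cross_eq0_colinear u v : cross u v = 0 -> dot u u *: v = dot u v *: u.
Proof.
move=> uv; apply/eqP; rewrite -subr_eq0 -dotvv_eq0.
have g : gram u v = 0 by rewrite gramE uv dot0r.
rewrite -scaleNr !dot_lin; rewrite /gram in g.
rewrite [dot v u]dotC; apply/eqP; transitivity (dot u u * gram u v); rewrite /gram.
  by ring.
by rewrite g mulr0.
Qed.

Lemma enorm_gt0 u : u != 0 -> 0 < enorm u.
Proof.
by move=> u0; rewrite sqrtr_gt0 lt_neqAle dotvv_ge0 andbT eq_sym dotvv_eq0.
Qed.

(** At a degenerate corner the sine of the angle is 0, so an angle below [pi] is 0. Both sides then
    leave the corner in the same direction, and the shorter one lies inside the other, although they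
    may share only the corner. *)
Lemma convex_corner q k : simple_quad q -> strictly_convex q ->
  cross (q (k + 1 + 1) - q (k + 1)) (q k - q (k + 1)) != 0.
Proof.
move=> sq [al [[w [w1 _ ang _]] alpi]].
have [/andP[a0 _] hd hs] := ang (k + 1); rewrite addrK in hd hs.
have apos := alpi (k + 1).
set u := q (k + 1 + 1) - q (k + 1) in hd hs *; set v := q k - q (k + 1) in hd hs *.
apply/eqP => uv; rewrite uv dot0r in hs.
have u0 : u != 0 by rewrite subr_eq0 eq_sym simple_quad_neq.
have v0 : v != 0 by rewrite subr_eq0 simple_quad_neq.
have sin0 : sin (al (k + 1)) = 0.
  move/esym/eqP: hs; rewrite mulf_eq0 mulf_eq0.
  by rewrite !(gt_eqF (enorm_gt0 _)) // => /eqP.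
have al0 : al (k + 1) = 0.
  apply/eqP; rewrite eq_le a0 andbT leNgt; apply/negP => ap.
  by have := sin_gt0_pi (introT andP (conj ap apos)); rewrite sin0 ltxx.
rewrite al0 cos0 mulr1 in hd.
have uvp : 0 < dot u v by rewrite hd mulr_gt0 // enorm_gt0.
have uup : 0 < dot u u by rewrite lt_neqAle dotvv_ge0 andbT eq_sym dotvv_eq0.
have vE : v = (dot u v / dot u u) *: u.
  apply: (scalerI (lt0r_neq0 uup)); rewrite (cross_eq0_colinear uv) scalerA.
  by rewrite [_ * (_ / _)]mulrC divfK // gt_eqF.
have [sides _] := sq; have side := sides k.
have kk : k + 2%:R = k + 1 + 1 :> 'I_4 by rewrite -addrA; congr (_ + _); exact: val_inj.
rewrite kk in side.
have qE : q (k + 1 + 1) = q (k + 1) + u by rewrite /u [RHS]addrC subrK.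
have qE' : q k = q (k + 1) + v by rewrite /v [RHS]addrC subrK.
have cp : 0 < dot u v / dot u u by rewrite divr_gt0.
have [c1|c1] := leP (dot u v / dot u u) 1.
- have : [set q (k + 1)] (q k).
    rewrite -side; split; first exact: segmentl.
    by rewrite qE qE' vE; apply: segment_scale; rewrite ltW.
  by move=> /= /eqP; rewrite (negPf (simple_quad_neq k sq)).
- have : [set q (k + 1)] (q (k + 1 + 1)).
    rewrite -side; split; last exact: segmentr.
    rewrite segmentC qE' qE; have uE : u = (dot u v / dot u u)^-1 *: v.
      by rewrite {2}vE scalerA mulVf ?gt_eqF // scale1r.
    have -> : q (k + 1) + u = q (k + 1) + (dot u v / dot u u)^-1 *: v by rewrite -uE.
    by apply: segment_scale; rewrite invr_ge0 ltW //= invf_le1 // ltW.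
  by move=> /= /esym /eqP; rewrite (negPf (simple_quad_neq _ sq)).
Qed.

Lemma motionB M b x y : motion M b x - motion M b y = (x - y) *m M.
Proof. by rewrite mulmxBl /motion; apply/rowP => i; rewrite !mxE; ring. Qed.

Lemma motion_inj M b : rotation M -> injective (motion M b).
Proof.
move=> [MM _] x y /addIr /(congr1 (mulmx^~ M^T)).
by rewrite -!mulmxA MM !mulmx1.
Qed.

Lemma motion_segment M b x y :
  segment (motion M b x) (motion M b y) = motion M b @` segment x y.
Proof.
have e s : (1 - s) *: motion M b x + s *: motion M b y = motion M b ((1 - s) *: x + s *: y).
  by rewrite /motion mulmxDl -!scalemxAl; apply/rowP => i; rewrite !mxE; ring.
apply/seteqP; split.
- by move=> _ [s s01 <-]; exists ((1 - s) *: x + s *: y) => //; exists s.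
- by move=> _ [_ [s s01 <-] <-]; exists s.
Qed.

Lemma image_setI_inj (T U : Type) (f : T -> U) (S S' : set T) : injective f ->
  f @` S `&` f @` S' = f @` (S `&` S').
Proof.
move=> fi; apply/seteqP; split.
- by move=> _ [[x Sx <-] [x' Sx' /fi xx']]; exists x => //; split=> //; rewrite -xx'.
- by move=> _ [x [Sx Sx'] <-]; split; exists x.
Qed.

Lemma planar_quad_motion M b q : rotation M -> planar_quad q ->
  planar_quad (fun k => motion M b (q k)).
Proof.
move=> rM [[w [c [w0 wc]]] [s1 s2]]; split; last split.
- exists (w *m M), (c + dot (w *m M) b); split.
    by rewrite -dotvv_eq0 dot_rotation // dotvv_eq0.
  move=> _ [k _ <-]; rewrite /motion dotDr dot_rotation // (wc (q k)) //.
- move=> k; rewrite !motion_segment image_setI_inj ?s1 ?image_set1 //.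
  exact: motion_inj.
- move=> k; rewrite !motion_segment image_setI_inj ?s2 ?image_set0 //.
  exact: motion_inj.
Qed.

(** Coordinates of the opposite vertex in the frame at corner 0. The cases [a = 0], [c = 0] and
    [a + c = 1] would make the corners 1, 3 and 2 degenerate. *)
Lemma quad_rel q : planar_quad q -> strictly_convex q -> exists a c : R,
  [/\ q 2%:R - q 0 = a *: (q 3%:R - q 0) + c *: (q 1 - q 0),
      a != 0, c != 0, a + c != 1 & cross (q 3%:R - q 0) (q 1 - q 0) != 0].
Proof.
move=> [[w [d [w0 wd]]] sq] cq.
have E (k l : 'I_4) : val k = val l -> k = l by exact: val_inj.
have c0 := convex_corner 3%:R sq cq.
have c1 := convex_corner 0 sq cq.
have c2 := convex_corner 1 sq cq.
have c3 := convex_corner 2%:R sq cq.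
have e31 : 3%:R + 1 = 0 :> 'I_4 by exact: E.
have e01 : 0 + 1 = 1 :> 'I_4 by exact: E.
have e11 : 1 + 1 = 2%:R :> 'I_4 by exact: E.
have e21 : 2%:R + 1 = 3%:R :> 'I_4 by exact: E.
rewrite !e31 !e01 in c0; rewrite !e01 !e11 in c1; rewrite !e11 !e21 in c2.
rewrite !e21 !e31 in c3.
have uv : cross (q 3%:R - q 0) (q 1 - q 0) != 0 by rewrite crossN oppr_eq0.
have wq k : dot w (q k - q 0) = 0.
  by rewrite dotDr dotNr !wd ?subrr.
have [a [c qE]] := coplanar_rel uv w0 (wq _) (wq _) (wq 2%:R).
exists a, c; set u := q 3%:R - q 0 in qE uv *; set v := q 1 - q 0 in qE uv *.
have q2 : q 2%:R = q 0 + (a *: u + c *: v) by rewrite -qE [RHS]addrC subrK.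
have q3 : q 3%:R = q 0 + u by rewrite /u [RHS]addrC subrK.
have q1 : q 1 = q 0 + v by rewrite /v [RHS]addrC subrK.
split=> //.
- apply: contraNneq c1 => a0; apply/eqP; rewrite q2 q1 a0.
  by apply/row3P; rewrite !(cross0, cross1, cross2) !mxE; split; ring.
- apply: contraNneq c3 => a0; apply/eqP; rewrite q2 q3 a0.
  by apply/row3P; rewrite !(cross0, cross1, cross2) !mxE; split; ring.
- apply: contraNneq c2 => ac; have aE : a = 1 - c by rewrite -ac addrK.
  apply/eqP; rewrite q2 q3 q1 aE.
  by apply/row3P; rewrite !(cross0, cross1, cross2) !mxE; split; ring.
Qed.

End Quad.

(** * Faces of a net, coplanarity and subnets *)

Section Faces.
Context {R : realType}.

(** [inord] sends indices out of range to 0, so index bounds accompany the relations on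
    [natnet p]. *)
Definition natnet (m n : nat) (p : net R m n) : nat -> nat -> 'rV[R]_3 :=
  fun i j => p (inord i) (inord j).

Lemma I4_ind (P : 'I_4 -> Prop) : P 0 -> P 1 -> P 2%:R -> P 3%:R -> forall k, P k.
Proof.
move=> P0 P1 P2 P3 [[|[|[|[|//]]]] k4].
- by rewrite (_ : Ordinal k4 = 0) //; exact: val_inj.
- by rewrite (_ : Ordinal k4 = 1) //; exact: val_inj.
- by rewrite (_ : Ordinal k4 = 2%:R) //; exact: val_inj.
- by rewrite (_ : Ordinal k4 = 3%:R) //; exact: val_inj.
Qed.

Lemma faceE m n (p : net R m n) (i : 'I_m) (j : 'I_n) :
  [/\ face p i j 0 = natnet p i j, face p i j 1 = natnet p i j.+1,
      face p i j 2%:R = natnet p i.+1 j.+1 & face p i j 3%:R = natnet p i.+1 j].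
Proof. by rewrite /face !(tnth_nth 0). Qed.

Implicit Types (A B : nat -> nat -> R) (p q : nat -> nat -> 'rV[R]_3).

(** The normal is the cross product of an upper edge with the hinge. The vanishing triple product
    puts the other upper edge into the plane, and the face relations bring in the remaining
    sides. *)
Lemma six_coplanar A B p i j : face_rel A B p i j -> face_rel A B p i j.+1 ->
  A i j != 0 -> cross (dn p i j) (rt p i j) != 0 ->
  trip (rt p i j) (dn p i j.+1) (rt p i j.+1) = 0 ->
  exists (w : 'rV[R]_3) (c : R), w != 0 /\
    [/\ dot w (p i j) = c, dot w (p i j.+1) = c, dot w (p i j.+2) = c &
     [/\ dot w (p i.+1 j) = c, dot w (p i.+1 j.+1) = c & dot w (p i.+1 j.+2) = c]].
Proof.
move=> r1 r2 A0 c0 t0; pose w := cross (rt p i j) (dn p i j.+1).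
have dE := dn_next r1.
have w1 : dot w (rt p i j) = 0 by exact: dot_crossl.
have w2 : dot w (dn p i j.+1) = 0 by exact: dot_crossr.
have w3 : dot w (rt p i j.+1) = 0 by exact: t0.
have w4 : dot w (dn p i j) = 0.
  by apply: (mulfI A0); move: w2; rewrite dE dotDr !dotZr w1 !mulr0 addr0.
have w5 : dot w (dn p i j.+2) = 0.
  by rewrite (dn_next r2) dotDr !dotZr w2 w3 !mulr0 addr0.
exists w, (dot w (p i j)); split.
  have -> : w = - (A i j) *: cross (dn p i j) (rt p i j).
    rewrite /w dE; move: (dn p i j) (rt p i j) => u v.
    by apply/row3P; rewrite !coordE; split; ring.
  by rewrite scaler_eq0 negb_or oppr_eq0 A0.
move: w1 w2 w3 w4 w5; rewrite /rt /dn !dotDr !dotNr; move: (dot w) => f.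
by move=> h1 h2 h3 h4 h5; split=> //; [lra|lra|split; lra].
Qed.

Lemma face_iso_motion A B p q i j : face_rel A B p i j ->
  cross (dn p i j) (rt p i j) != 0 -> face_iso A B p q i j ->
  exists (M : 'M[R]_3) (b : 'rV[R]_3), rotation M /\
  [/\ q i j = motion M b (p i j), q i j.+1 = motion M b (p i j.+1),
      q i.+1 j.+1 = motion M b (p i.+1 j.+1) & q i.+1 j = motion M b (p i.+1 j)].
Proof.
move=> rp c0 [rq [g1 g2 g3]].
have [M [rM Md Mr]] := frame_rotation c0 g1 g3 g2.
exists M, (q i j - p i j *m M); split=> //.
have ok x y : y - q i j = (x - p i j) *m M -> y = motion M (q i j - p i j *m M) x.
  by move=> /(canRL (subrK _)) ->; rewrite /motion mulmxBl; apply/rowP => k; rewrite !mxE; ring.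
split; apply: ok => //; first by rewrite !subrr mul0mx.
rewrite rp rq -Md -Mr; move: (dn p i j) (rt p i j) => u v.
by rewrite mulmxDl -!scalemxAl.
Qed.

Lemma motion_face_iso A B p q i j (M : 'M[R]_3) (b : 'rV[R]_3) : rotation M ->
  face_rel A B p i j ->
  q i j = motion M b (p i j) -> q i j.+1 = motion M b (p i j.+1) ->
  q i.+1 j.+1 = motion M b (p i.+1 j.+1) -> q i.+1 j = motion M b (p i.+1 j) ->
  face_iso A B p q i j.
Proof.
move=> rM rp h1 h2 h3 h4; rewrite /face_iso /face_rel /face_gram /dn /rt h1 h2 h3 h4.
rewrite !motionB !dot_rotation //; split=> //.
rewrite rp /dn /rt; move: (p i.+1 j - p i j) (p i j.+1 - p i j) => u v.
by rewrite mulmxDl -!scalemxAl.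
Qed.

Lemma regular_net m n (p : net R m n) : conjugate_net p -> strictly_convex_faces p ->
  (forall f g : 'I_m * 'I_n, adjacent_faces f g -> ~ coplanar_faces p f g) ->
  exists A B, regular m n A B (natnet p).
Proof.
move=> pq cv nc; pose P := natnet p.
have /choice[F hF] : forall ij : nat * nat, exists ac : R * R,
  (ij.1 < m)%N -> (ij.2 < n)%N ->
  [/\ P ij.1.+1 ij.2.+1 - P ij.1 ij.2 = ac.1 *: dn P ij.1 ij.2 + ac.2 *: rt P ij.1 ij.2,
      ac.1 != 0, ac.2 != 0, ac.1 + ac.2 != 1 & cross (dn P ij.1 ij.2) (rt P ij.1 ij.2) != 0].
  move=> [i j] /=; have [im|im] := ltnP i m; last by exists (0, 0).
  have [jn|jn] := ltnP j n; last by exists (0, 0).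
  have [a [c]] := quad_rel (pq (Ordinal im) (Ordinal jn)) (cv (Ordinal im) (Ordinal jn)).
  have [-> -> -> ->] := faceE p (Ordinal im) (Ordinal jn).
  by move=> h; exists (a, c).
exists (fun i j => (F (i, j)).1), (fun i j => (F (i, j)).2).
have rel i j : (i < m)%N -> (j < n)%N ->
    face_rel (fun i j => (F (i, j)).1) (fun i j => (F (i, j)).2) P i j.
  by move=> im jn; case: (hF (i, j) im jn).
have A0 i j : (i < m)%N -> (j < n)%N -> (F (i, j)).1 != 0.
  by move=> im jn; case: (hF (i, j) im jn).
have B0 i j : (i < m)%N -> (j < n)%N -> (F (i, j)).2 != 0.
  by move=> im jn; case: (hF (i, j) im jn).
have c0 i j : (i < m)%N -> (j < n)%N -> cross (dn P i j) (rt P i j) != 0.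
  by move=> im jn; case: (hF (i, j) im jn).
split=> // i j im jn.
- by case: (hF (i, j) im jn).
- have jn' := ltnW jn; apply/eqP => t0.
  have [w [c [w0 [h1 h2 h3 [h4 h5 h6]]]]] :=
    six_coplanar (rel _ _ im jn') (rel _ _ im jn) (A0 _ _ im jn') (c0 _ _ im jn') t0.
  apply: (nc (Ordinal im, Ordinal jn') (Ordinal im, Ordinal jn)).
    by left; split=> //; left.
  have [f0 f1 f2 f3] := faceE p (Ordinal im) (Ordinal jn').
  have [g0 g1 g2 g3] := faceE p (Ordinal im) (Ordinal jn).
  by exists w, c; split=> // x [] [k _ <-] /=; move: k; apply: I4_ind;
    rewrite ?f0 ?f1 ?f2 ?f3 ?g0 ?g1 ?g2 ?g3.
- have im' := ltnW im; apply/eqP => t0.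
  have rt0 : trip (rt (tr P) j i) (dn (tr P) j i.+1) (rt (tr P) j i.+1) = 0 by exact: t0.
  have cr0 : cross (dn (tr P) j i) (rt (tr P) j i) != 0.
    by rewrite crossN oppr_eq0; exact: (c0 _ _ im' jn).
  have [w [c [w0 [h1 h2 h3 [h4 h5 h6]]]]] :=
    six_coplanar (face_rel_tr (rel _ _ im' jn)) (face_rel_tr (rel _ _ im jn))
      (B0 _ _ im' jn) cr0 rt0.
  apply: (nc (Ordinal im', Ordinal jn) (Ordinal im, Ordinal jn)).
    by right; split=> //; left.
  have [f0 f1 f2 f3] := faceE p (Ordinal im') (Ordinal jn).
  have [g0 g1 g2 g3] := faceE p (Ordinal im) (Ordinal jn).
  by exists w, c; split=> // x [] [k _ <-] /=; move: k; apply: I4_ind;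
    rewrite ?f0 ?f1 ?f2 ?f3 ?g0 ?g1 ?g2 ?g3.
Qed.

Lemma subnet33_transfer m n (p : net R m n) A B a b : regular m n A B (natnet p) ->
  (a.+2 < m)%N -> (b.+2 < n)%N -> flexible (subnet33 p a b) ->
  \forall x \near (0 : R),
  transfer A B (natnet p) a.+1 b.+1
    (transferV A B (natnet p) a.+1 b (transfer A B (natnet p) a b x))
    = transfer A B (natnet p) a b.+1 x.
Proof.
move=> reg am bn [e [P [e0 [P0 Ps _ Piso] Pnt]]].
(* The indices of the deformed subnet are shifted to those of [natnet p]. *)
pose Q s k l : 'rV[R]_3 := P s (inord (k - a)) (inord (l - b)).
have subE k l : (k <= 3)%N -> (l <= 3)%N ->
    subnet33 p a b (inord k) (inord l) = natnet p (a + k) (b + l).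
  by move=> k3 l3; rewrite /subnet33 /natnet !inordK.
have QE s k l : natnet (P s) k l = Q s (a + k)%N (b + l)%N by rewrite /Q !addKn.
have win k l : (a <= k <= a.+3)%N -> (b <= l <= b.+3)%N ->
    exists k' l', [/\ (k' <= 3)%N, (l' <= 3)%N, k = (a + k')%N & l = (b + l')%N].
  by move=> /andP[? ?] /andP[? ?]; exists (k - a)%N, (l - b)%N; split; lia.
have natE k l : (k <= 3)%N -> (l <= 3)%N ->
    natnet (subnet33 p a b) k l = natnet p (a + k) (b + l) by exact: subE.
apply: (@flexible_transfer _ _ _ _ _ _ reg _ _ am bn e Q e0).
- move=> s k l se c; exact: smooth_on_continuous (Ps _ _ c) se.
- move=> k l /win/[apply] -[k' [l' [k3 l3 -> ->]]].
  by rewrite -QE -natE // /natnet P0.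
- move=> s k l se /andP[ka lb].
  have [k' [l' [k3 l3 -> ->]]] : exists k' l',
      [/\ (k' < 3)%N, (l' < 3)%N, k = (a + k')%N & l = (b + l')%N].
    by exists (k - a)%N, (l - b)%N; split; lia.
  have [M [c [rM hM]]] := Piso s se (Ordinal k3) (Ordinal l3).
  have [f0 f1 f2 f3] := faceE (P s) (Ordinal k3) (Ordinal l3).
  have [g0 g1 g2 g3] := faceE (subnet33 p a b) (Ordinal k3) (Ordinal l3).
  have := hM 0; have := hM 1; have := hM 2%:R; have := hM 3%:R.
  rewrite f0 f1 f2 f3 g0 g1 g2 g3 !QE /= !natE ?(ltnW k3) ?(ltnW l3) // !addnS => h3 h2 h1 h0.
  apply: (motion_face_iso rM _ h0 h1 h2 h3); apply: (reg_rel reg); lia.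
- apply: contrapT => hno; apply: Pnt => s se.
  have [M [c [rM hM]]] : exists (M : 'M[R]_3) (c : 'rV[R]_3), rotation M /\
    forall k l, (a <= k <= a.+3)%N -> (b <= l <= b.+3)%N -> Q s k l = motion M c (natnet p k l).
    by apply: contrapT => h; apply: hno; exists s.
  exists M, c; split=> // k l z.
  have ok k' l' : (k' <= 3)%N -> (l' <= 3)%N ->
      natnet (P s) k' l' = motion M c (natnet (subnet33 p a b) k' l').
    by move=> k3 l3; rewrite QE natE // hM //; lia.
  have [k3 l3] := (ltn_ord k, ltn_ord l).
  have [f0 f1 f2 f3] := faceE (P s) k l.
  have [g0 g1 g2 g3] := faceE (subnet33 p a b) k l.
  by move: z; apply: I4_ind; rewrite ?f0 ?f1 ?f2 ?f3 ?g0 ?g1 ?g2 ?g3; apply: ok; lia.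
Qed.

(** [radical_on e] is inherited by smaller [e], so the half-width itself can be taken near 0 and a
    finite intersection of neighbourhoods yields a common one. *)
Lemma radical_on_uniform (I : finType) (f : I -> R -> R) : (forall i, radical (f i)) ->
  \forall e \near (0 : R), forall i, radical_on e (f i).
Proof.
move=> rf; have h i : \forall e \near (0 : R), radical_on e (f i).
  have [e e0 re] := rf i.
  by apply: (ex_near0 e0) => x /andP[_ xe]; apply: radical_on_le re; exact: ltW.
exact: (filter_forall _ h).
Qed.

End Faces.

Theorem theorem5 (R : realType) (m n : nat) (p : net R m n)
  (hmn : (1 < m * n)%N)
  (hnet : conjugate_net p)
  (hconvex : strictly_convex_faces p)
  (hcoplanar : forall f g : 'I_m * 'I_n, adjacent_faces f g -> ~ coplanar_faces p f g)
  (hsub : forall a b : nat, (a + 3 <= m)%N -> (b + 3 <= n)%N ->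
    flexible (subnet33 p a b)) :
  flexible p.
Proof.
have [A [B reg]] := regular_net hnet hconvex hcoplanar.
have /andP[m0 n0] : (0 < m)%N && (0 < n)%N by rewrite -muln_gt0 ltnW.
(* Two faces already give an interior line, whose parameter will be [t]. *)
have mn1 : (1 < m)%N || (1 < n)%N by nia.
have win i j : (i.+2 < m)%N -> (j.+2 < n)%N -> \forall x \near (0 : R),
  transfer A B (natnet p) i.+1 j.+1
    (transferV A B (natnet p) i.+1 j (transfer A B (natnet p) i j x))
    = transfer A B (natnet p) i j.+1 x.
  by move=> im jn; apply: subnet33_transfer => //; apply: hsub; lia.
have [x [y [rx ry xy first]]] := hinge_functions reg win.
have [q [rq q0 iso hy hx]] := net_of_hinge_functions reg m0 n0 rx ry xy.
have smooth : \forall e \near (0 : R), forall ijc : 'I_m.+1 * 'I_n.+1 * 'I_3,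
    radical_on e (fun t => q t ijc.1.1 ijc.1.2 0 ijc.2).
  by apply: radical_on_uniform => -[[i j] c] /=; apply: rq; rewrite -ltnS.
have isos (ij : 'I_m * 'I_n) : \forall t \near (0 : R), face_iso A B (natnet p) (q t) ij.1 ij.2.
  exact: iso.
have {}isos := filter_forall _ isos.
have nontriv : \forall t \near (0 : R),
  if (1 < m)%N then vpar A B (natnet p) (q t) 0 0 = t else hpar A B (natnet p) (q t) 0 0 = t.
  move: first mn1; case: ifP => [m1 x0 _|_ y0 /= n1].
    by have h := hx 0%N m1; near=> t; rewrite (near h t) // x0.
  by have h := hy 0%N n1; near=> t; rewrite (near h t) // y0.
have /near0_ex[d d0 hd] : \forall t \near (0 : R), [/\
  forall ijc : 'I_m.+1 * 'I_n.+1 * 'I_3, radical_on t (fun t => q t ijc.1.1 ijc.1.2 0 ijc.2),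
  forall ij : 'I_m * 'I_n, face_iso A B (natnet p) (q t) ij.1 ij.2 &
  if (1 < m)%N then vpar A B (natnet p) (q t) 0 0 = t else hpar A B (natnet p) (q t) 0 0 = t].
  by near=> t; split; near: t; [exact: smooth|exact: isos|exact: nontriv].
(* In [hd] the variable also serves as the half-width of [radical_on]; halving puts [e] itself
   inside the open interval. *)
pose e := d / 2; have e0 : 0 < e by rewrite /e; lra.
have ed t : - e < t < e -> - d < t < d.
  by rewrite /e => /andP[? ?]; apply/andP; split; lra.
have de : - d < e < d by rewrite /e; apply/andP; split; lra.
pose P t : net R m n := fun i j => q t i j.
have PE t i j : (i <= m)%N -> (j <= n)%N -> natnet (P t) i j = q t i j.
  by move=> im jn; rewrite /natnet /P !inordK.
have motions t : - e < t < e -> forall (i : 'I_m) (j : 'I_n),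
   exists (M : 'M[R]_3) (b : 'rV[R]_3), rotation M /\
     forall k, face (P t) i j k = motion M b (face p i j k).
  move=> /ed/hd[_ h _] i j; have [im jn] := (ltn_ord i, ltn_ord j).
  have [M [b [rM [h0 h1 h2 h3]]]] :=
    face_iso_motion (reg_rel reg im jn) (reg_cross reg im jn) (h (i, j)).
  exists M, b; split=> //; have [f0 f1 f2 f3] := faceE (P t) i j.
  have [g0 g1 g2 g3] := faceE p i j.
  by apply: I4_ind; rewrite ?f0 ?f1 ?f2 ?f3 ?g0 ?g1 ?g2 ?g3 PE // ltnW.
exists e, P; split=> //.
  split=> //.
  - move=> i j; rewrite /P q0; first by rewrite /natnet !inord_val.
      by rewrite -ltnS.
    by rewrite -ltnS.
  - move=> i j c; have [h _ _] := hd e de.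
    exact: radical_on_smooth (h (i, j, c)).
  - move=> t te i j; have [M [b [rM hM]]] := motions t te i j.
    have -> : face (P t) i j = fun k => motion M b (face p i j k) by apply/funext.
    exact: planar_quad_motion.
(* A common motion of all faces preserves dot products and gives the first interior line the
   parameter 0, whereas its parameter is [t]; any nonzero [t] in the interval yields the
   contradiction. *)
move=> triv; pose t := e / 2.
have te : - e < t < e by rewrite /t; apply/andP; split; lra.
have t0 : t != 0 by rewrite /t; apply: lt0r_neq0; lra.
have [M [b [rM hM]]] := triv t te.
have mot i j : (i < m)%N -> (j < n)%N ->
    dn (q t) i j = dn (natnet p) i j *m M /\ rt (q t) i j = rt (natnet p) i j *m M.
  move=> im jn; have := hM (Ordinal im) (Ordinal jn).
  have [f0 f1 f2 f3] := faceE (P t) (Ordinal im) (Ordinal jn).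
  have [g0 g1 g2 g3] := faceE p (Ordinal im) (Ordinal jn) => h.
  have := h 0; have := h 1; have := h 3%:R.
  rewrite f0 f1 f3 g0 g1 g3 !PE ?(ltnW im) ?(ltnW jn) // /dn /rt => -> -> ->.
  by rewrite !motionB.
have [_ _] := hd t (ed t te).
case: ifP mn1 => [m1 _|_ n1].
  rewrite /vpar /hpar -[hdot (tr (q t)) 0 0]/(vdot (q t) 0 0).
  rewrite -[hdot (tr (natnet p)) 0 0]/(vdot (natnet p) 0 0) /vdot.
  rewrite (mot 0%N 0%N m0 n0).1 (mot 1%N 0%N m1 n0).1 dot_rotation // subrr mul0r => /esym.
  exact/eqP.
rewrite /hpar /hdot.
rewrite (mot 0%N 0%N m0 n0).2 (mot 0%N 1%N m0 n1).2 dot_rotation // subrr mul0r => /esym.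
exact/eqP.
Unshelve. all: by end_near. Qed.
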